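(* Let $k_1,\dots,k_n$ be natural numbers, $L=\min\{k_1,\dots,k_n\}$, $M=k_1+\cdots+k_n-n$, and let $m$ be an integer (possibly negative) satisfying $m\le L-1$. Suppose $n$ algebraic hypersurfaces without multiple factors $f_1(X)=0,\dots,f_n(X)=0$ in $\mathbb{C}^n$, of degrees $k_1,\dots,k_n$ respectively, meet exactly at $N=k_1\cdots k_n$ distinct points, and write $\mathcal{A}=\{Q^{(i)}\}_{i=1}^N$ for the set of these points. Let $\mathcal{B}\subseteq\mathcal{A}$ be a properly posed set of nodes (PPSN) for $\mathbb{P}_m^{(n)}$. Let $1\le t\le n$. If $\mathcal{A}^t$ is a PPSN for Lagrange interpolation of degree $M-m-k_t-1$ along the algebraic manifold $S_1^{(t)}=s(f_1,\dots,f_{t-1},f_{t+1},\dots,f_n)$ and $\mathcal{A}^t\cap\mathcal{A}=\emptyset$, then $\mathcal{A}^t\cup(\mathcal{A}\setminus\mathcal{B})$ is a PPSN for Lagrange interpolation of degree $M-m-1$ along $S_1^{(t)}$.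
   Context: $X=(x_1,\dots,x_n)$. $\mathbb{P}_m^{(n)}$ is the complex vector space of polynomials in $\mathbb{C}[x_1,\dots,x_n]$ of total degree $\le m$; for $m<0$, $\mathbb{P}_m^{(n)}=\{0\}$, and the corresponding PPSN is the empty set. $s(\cdot)$ denotes the set of common zeros in $\mathbb{C}^n$ of the listed polynomials. A hypersurface $f(X)=0$ is without multiple factors if $f$ has no repeated non-constant factor. For every integer $m$, $e_m^{(n)}=\binom{m+n}{n}$, with $e_m^{(n)}=0$ for $m<0$. With $\nabla_k u_m=u_m-u_{m-k}$, put $e_m^{(n)}(k_1,\dots,k_s)=\nabla_{k_s}\cdots\nabla_{k_1}e_m^{(n)}$. PPSN for $\mathbb{P}_m^{(n)}$: a set of $e_m^{(n)}$ distinct points $Q^{(i)}$ of $\mathbb{C}^n$ such that for all complex numbers $q_i$ there is a unique $f\in\mathbb{P}_m^{(n)}$ with $f(Q^{(i)})=q_i$ for all $i$. PPSN along a manifold: let $S=s(p_1,\dots,p_s)$, where $p_1,\dots,p_s$ have degrees $l_1,\dots,l_s$. A set of exactly $e_d^{(n)}(l_1,\dots,l_s)$ distinct points $Q^{(i)}$ on $S$ is a PPSN for Lagrange interpolation of degree $d$ along $S$ if for all complex numbers $q_i$ there exists $f\in\mathbb{P}_d^{(n)}$ with $f(Q^{(i)})=q_i$ for all $i$. For $S_1^{(t)}$ the degrees are $k_1,\dots,k_{t-1},k_{t+1},\dots,k_n$. *)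

(* Defs.v *)
From mathcomp Require Import all_boot all_order all_algebra.
From mathcomp Require Import finmap mpoly complex reals.

Set Implicit Arguments.
Unset Strict Implicit.
Unset Printing Implicit Defensive.

Import Order.TTheory GRing.Theory Num.Theory.

Local Open Scope ring_scope.
Local Open Scope fset_scope.

Section Interpolation.

Variables (K : fieldType) (n : nat).

(* The membership predicate is split on the sign of [m] so that it is {0} for
   every [m < 0]; [(msize f)%:Z <= m + 1] would exclude even 0 when [m < -1]. *)
Definition polyspace (m : int) : pred {mpoly K[n]} :=
  fun f => if m is Posz d then (msize f <= d.+1)%N else f == 0.

(* [msize p] is the total degree plus one when [p != 0]. *)
Definition tdeg (p : {mpoly K[n]}) : nat := (msize p).-1.

Definition no_multiple_factors (f : {mpoly K[n]}) : Prop :=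
  forall p q : {mpoly K[n]}, f = p ^+ 2 * q -> exists c : K, p = c%:MP.

Definition common_zeros (ps : seq {mpoly K[n]}) : pred {ffun 'I_n -> K} :=
  fun Q => all (fun p => p.@[Q] == 0) ps.

Definition space_dim (m : int) : int :=
  if m is Posz d then 'C(d + n, n)%:Z else 0.

Definition backward_diff (u : int -> int) (k : nat) : int -> int :=
  fun m => u m - u (m - k%:Z).

(* nabla_{k_s} ... nabla_{k_1} applied to [space_dim], for ks = [k_1; ...; k_s]. *)
Definition space_dim_diff (ks : seq nat) : int -> int :=
  foldl backward_diff space_dim ks.

(* The prescribed values are given by a function on all of K^n, of which only
   the restriction to [B] matters. *)
Definition PPSN (m : int) (B : {fset {ffun 'I_n -> K}}) : Prop :=
  #|` B|%:Z = space_dim m /\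
  forall q : {ffun 'I_n -> K} -> K,
    exists! f : {mpoly K[n]},
      polyspace m f /\ (forall Q, Q \in B -> f.@[Q] = q Q).

Definition PPSN_along (ps : seq {mpoly K[n]}) (d : int)
    (B : {fset {ffun 'I_n -> K}}) : Prop :=
  [/\ #|` B|%:Z = space_dim_diff [seq tdeg p | p <- ps] d,
      {subset B <= common_zeros ps} &
      forall q : {ffun 'I_n -> K} -> K,
        exists f : {mpoly K[n]},
          polyspace d f /\ (forall Q, Q \in B -> f.@[Q] = q Q)].

End Interpolation.

(* Main.v *)
From HB Require Import structures.
Require Import Defs.
From mathcomp Require Import all_boot all_order all_algebra.
From mathcomp Require Import finmap mpoly complex reals boolp.
From mathcomp Require Import ring zify.

(** Write N for the product of the k_i, which is the number of points of A, and
M for the sum of the k_i - 1.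

The interpolation statement reduces to one about A alone. Suppose that g has
degree at most d = M - m - 1 and takes the prescribed values on A \ B. Adding a
multiple f_t h does not change g on A, where f_t vanishes, whereas f_t has no
zero on At, since a zero of f_t on S1 lies in A. So h, of degree at most
d - k_t, can be chosen to correct the values on At. The number of points is the
right one because the Hilbert function H of a complete intersection satisfies
H(d) + H(M - 1 - d) = N ([space_dim_diff_symmetry]), and H(m) is the dimension
of the space of polynomials of degree at most m when m is less than every k_i.

That A \ B imposes independent conditions in degree d is a form of the
Cayley-Bacharach theorem ([cayley_bacharach]), and the Bezoutian proves it.
Write f_i(y) - f_i(x) as the sum over j of (y_j - x_j) D_ij(x, y); then
Theta = det D has total degree at most M in (x, y). It vanishes at two distinct
points x, y of A, because y - x is then in the kernel of D(x, y). Let c, zero on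
B, satisfy sum_Q c_Q p(Q) = 0 for all p of degree at most d. In
g(y) = sum_Q c_Q Theta(Q, y) only the terms of degree more than d in x survive;
they have degree at most m in y. As g vanishes on B, which is unisolvent in
degree m, g is zero; but g(Q) = c_Q Theta(Q, Q). Hence c = 0, provided that
Theta(Q, Q), the Jacobian determinant of f at Q, does not vanish.

So the zeros of f must be simple: a finite zero set with a multiple zero has
fewer than N points ([double_zero_bound]). After a change of coordinates the
multiple zero is the origin and the common tangent vector is a coordinate
vector e_i with k_i >= 2. The origin then remains a multiple zero of every
member f_i + s x_i^(k_i) of a pencil. At s = oo the quotient by this ideal is
spanned by the N monomials with all exponents less than the k_i, so the powers
of a linear form h satisfy a relation Phi_s(h) = 0 of degree at most N whose
coefficients are polynomials in s ([pencil_relation]); it can be normalised so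
that Phi_0 is not zero. Then Phi_0 has a double root from the origin and a root
h(Q) for every other zero Q, because isolated zeros persist in a pencil
([persistence]). When h separates A, this leaves room for fewer than N points.

Persistence is a dimension statement: n elements of a polynomial ring in n + 1
variables cannot generate an ideal that is primary at the origin, because the
powers of such an ideal have too small a colength ([height_theorem]). That the
zeros are isolated is turned into a statement about the ideal by a
Nullstellensatz ([nullstellensatz]), which has a short proof over an uncountable
field. *)

Set Implicit Arguments.
Unset Strict Implicit.
Unset Printing Implicit Defensive.

Import Order.TTheory GRing.Theory Num.Theory.

Local Open Scope ring_scope.

(** * Uncountability of the complex field *)

(** Uncountability as an infinite pigeonhole principle: a countable type fails
it through an injection into [nat]. *)
Definition has_large_fibre (T : eqType) :=
  forall c : T -> nat, exists j, forall b, exists s : seq T,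
    [/\ uniq s, size s = b & all (fun a => c a == j) s].

Lemma shrink_interval (R : realFieldType) (s : seq R) (l r : R) : l < r ->
  exists I : R * R, [/\ l <= I.1, I.1 < I.2, I.2 <= r &
    forall x, x \in s -> ~~ (I.1 <= x <= I.2)].
Proof.
elim: s l r => [|y s IHs] l r lr; first by exists (l, r).
have [l' [r' [ll' lr' rr' yN]]] : exists l' r', [/\ l <= l', l' < r', r' <= r &
    ~~ (l' <= y <= r')].
  have lm := midf_lt lr; set m := (l + r) / 2%:R in lm.
  have [lm1 mr] := lm.
  have [ym|my] := leP y m.
    have [mx xr] := midf_lt mr; set x := (m + r) / 2%:R in mx xr.
    exists x, r; split=> //; first by rewrite ltW // (lt_trans lm1).
    by rewrite negb_and -!ltNge (le_lt_trans ym mx).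
  exists l, m; split=> //; first exact: ltW.
  by rewrite negb_and -!ltNge my orbT.
have [I [lI II Ir IN]] := IHs _ _ lr'.
exists I; split=> //; [exact: le_trans lI|exact: le_trans rr'|].
move=> x; rewrite inE => /predU1P[->|]; last exact: IN.
apply: contra yN => /andP[Iy yI].
by rewrite (le_trans lI Iy) (le_trans yI Ir).
Qed.

(** Cantor's nested intervals: the interval chosen at stage j avoids [L j], and
the supremum of the left ends lies in all of them. *)
Lemma realType_notin_cover (R : realType) (L : nat -> seq R) :
  exists x, forall j, x \notin L j.
Proof.
have /choice [step stepP] : forall P : nat * (R * R), exists I : R * R,
    P.2.1 < P.2.2 -> [/\ P.2.1 <= I.1, I.1 < I.2, I.2 <= P.2.2 &
    forall x, x \in L P.1 -> ~~ (I.1 <= x <= I.2)].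
  move=> [j [l r]] /=; have [lr|_] := ltP l r; last by exists (0, 0).
  by have [I ?] := shrink_interval (L j) lr; exists I.
pose fix I j : R * R := if j is j'.+1 then step (j', I j') else (0, 1).
have Ilt j : (I j).1 < (I j).2.
  by elim: j => [|j IHj] /=; [exact: ltr01|have [] := stepP (j, I j) IHj].
have Istep j : [/\ (I j).1 <= (I j.+1).1, (I j.+1).2 <= (I j).2 &
    forall x, x \in L j -> ~~ ((I j.+1).1 <= x <= (I j.+1).2)].
  by have [] := stepP (j, I j) (Ilt j).
have Imono j i : (I j).1 <= (I (i + j)%N).1 /\ (I (i + j)%N).2 <= (I j).2.
  elim: i => [//|i [IH1 IH2]]; have [S1 S2 _] := Istep (i + j)%N.
  by split; [exact: le_trans S1|exact: le_trans IH2].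
have Icross i j : (I i).1 <= (I j).2.
  have [ij|/ltnW ji] := leqP i j.
    have [+ _] := Imono i (j - i)%N; rewrite subnK // => h.
    exact: le_trans h (ltW (Ilt _)).
  have [_ +] := Imono j (i - j)%N; rewrite subnK // => h.
  exact: le_trans (ltW (Ilt _)) h.
pose E : classical_sets.set R := fun x => exists i, x = (I i).1.
have ubE j : classical_sets.ubound E (I j).2 by move=> _ [i ->]; exact: Icross.
have supE : classical_sets.has_sup E.
  by split; [exists (I 0%N).1, 0%N|exists (I 0%N).2; exact: ubE].
exists (sup E) => j; have [_ _ avoid] := Istep j.
apply/negP => /avoid /negP[]; apply/andP; split.
  by apply: sup_upper_bound => //; exists j.+1.
by apply: sup_le_ub; [case: supE|exact: ubE].
Qed.

(** If no fibre were arbitrarily large, all of them would be finite, and the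
real parts of their elements would cover the reals by a sequence of finite
lists. *)
Lemma complex_has_large_fibre (R : realType) : has_large_fibre (complex R).
Proof.
move=> c; apply: contrapT => small.
have /choice [L LP] : forall j, exists L : seq (complex R), forall a, c a = j ->
    a \in L.
  move=> j; apply: contrapT => unlisted; apply: small; exists j.
  elim=> [|b [s [us sb cs]]]; first by exists [::].
  have [a ca as_] : exists2 a, c a = j & a \notin s.
    apply: contrapT => inS; apply: unlisted; exists s => a ca.
    by apply: contrapT => /negP as_; apply: inS; exists a.
  by exists (a :: s); rewrite /= as_ us sb ca eqxx cs.
have [x xL] := realType_notin_cover (fun j => [seq complex.Re z | z <- L j]).
have /negP[] := xL (c (Complex x 0)).
by apply/mapP; exists (Complex x 0) => //; exact: LP.
Qed.

(** * Linear algebra and ideals *)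

Lemma nonzero_solution (K : fieldType) (I J : finType) (M : I -> J -> K) :
  (#|I| < #|J|)%N -> exists2 l : J -> K, (exists j, l j != 0) &
    forall i, \sum_j M i j * l j = 0.
Proof.
move=> IJ; pose A := \matrix_(j < #|J|, i < #|I|) M (enum_val i) (enum_val j).
have /rowV0Pn[v vA v0] : kermx A != 0.
  rewrite -mxrank_eq0 mxrank_ker subn_eq0 -ltnNge.
  exact: leq_ltn_trans (rank_leq_col A) IJ.
exists (fun j => v 0 (enum_rank j)).
  have /rV0Pn[j vj] := v0.
  by exists (enum_val j); rewrite enum_valK.
move=> i; have /sub_kermxP/rowP/(_ (enum_rank i)) := vA.
rewrite !mxE (reindex _ (onW_bij _ (@enum_rank_bij J))) /= => E.
rewrite -[RHS]E; apply: eq_bigr => j _.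
by rewrite mxE !enum_rankK mulrC.
Qed.

Definition is_ideal (S : comNzRingType) (I : S -> Prop) :=
  [/\ I 0, forall p q, I p -> I q -> I (p + q) & forall a p, I p -> I (a * p)].

Section IdealTheory.

Variables (S : comNzRingType) (I : S -> Prop).
Hypothesis idI : is_ideal I.

Lemma ideal0 : I 0. Proof. by case: idI. Qed.

Lemma idealD p q : I p -> I q -> I (p + q).
Proof. by case: idI => _ + _; apply. Qed.

Lemma idealMl a p : I p -> I (a * p).
Proof. by case: idI => _ _; apply. Qed.

Lemma idealN p : I p -> I (- p).
Proof. by rewrite -mulN1r; apply: idealMl. Qed.

Lemma idealB p q : I p -> I q -> I (p - q).
Proof. by move=> Ip Iq; apply: idealD => //; apply: idealN. Qed.

Lemma ideal_sum (T : Type) (r : seq T) (P : pred T) (F : T -> S) :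
  (forall i, P i -> I (F i)) -> I (\sum_(i <- r | P i) F i).
Proof. by move=> IF; apply: big_ind => //; [exact: ideal0|exact: idealD]. Qed.

End IdealTheory.

Definition gen_ideal (S : comNzRingType) n (F : 'I_n -> S) (p : S) :=
  exists a : 'I_n -> S, p = \sum_i a i * F i.

Lemma gen_ideal_ideal (S : comNzRingType) n (F : 'I_n -> S) :
  is_ideal (gen_ideal F).
Proof.
split=> [|p q [a ->] [b ->]|c p [a ->]].
- by exists (fun _ => 0); rewrite big1 // => i _; rewrite mul0r.
- exists (fun i => a i + b i); rewrite -big_split; apply: eq_bigr => i _ /=.
  by rewrite mulrDl.
- exists (fun i => c * a i); rewrite mulr_sumr; apply: eq_bigr => i _.
  by rewrite mulrA.
Qed.

Lemma gen_ideal_gen (S : comNzRingType) n (F : 'I_n -> S) i : gen_ideal F (F i).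
Proof.
exists (fun j => (j == i)%:R); rewrite (bigD1 i) //= eqxx mul1r big1 ?addr0 //.
by move=> j /negPf->; rewrite mul0r.
Qed.

Lemma gen_ideal_sub (S : comNzRingType) n (F : 'I_n -> S) (I : S -> Prop) p :
  is_ideal I -> (forall i, I (F i)) -> gen_ideal F p -> I p.
Proof.
by move=> idI IF [a ->]; apply: ideal_sum => // i _; apply: idealMl.
Qed.

Lemma preim_ideal (S S' : comNzRingType) (h : {rmorphism S -> S'})
  (I : S' -> Prop) : is_ideal I -> is_ideal (fun p => I (h p)).
Proof.
move=> idI; split=> [|p q Ip Iq|a p Ip].
- by rewrite rmorph0; apply: ideal0.
- by rewrite rmorphD; apply: idealD.
- by rewrite rmorphM; apply: idealMl.
Qed.

(** * A Nullstellensatz over uncountable algebraically closed fields *)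

Section Nullstellensatz.

Variables (K : closedFieldType) (n : nat).
Hypothesis largeK : has_large_fibre K.

Implicit Types (I : {mpoly K[n]} -> Prop) (p q : {mpoly K[n]}).

(** The ideal I + (X_i - a). *)
Definition add_root I (i : 'I_n) (a : K) (g : {mpoly K[n]}) :=
  exists q, I (g - q * ('X_i - a%:MP)).

Lemma add_root_ideal I i a : is_ideal I -> is_ideal (add_root I i a).
Proof.
move=> idI; split=> [|p q [r Ir] [s Is]|b p [r Ir]].
- by exists 0; rewrite mul0r subr0; apply: ideal0.
- exists (r + s); rewrite mulrDl opprD addrACA; exact: idealD.
- by exists (b * r); rewrite -mulrA -mulrBr; apply: idealMl.
Qed.

Lemma sub_add_root I i a g : I g -> add_root I i a g.
Proof. by exists 0; rewrite mul0r subr0. Qed.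

Lemma add_root_X I i a : is_ideal I -> add_root I i a ('X_i - a%:MP).
Proof. by move=> idI; exists 1; rewrite mul1r subrr; apply: ideal0. Qed.

(** If every a failed, each X_i - a would divide some power p^T modulo I, with
a quotient q_a. By uncountability there are more scalars a with the same T and
the same bound on deg q_a than the dimension of the space where the q_a live,
so these q_a are linearly dependent. Clearing denominators in the formal
relation sum_a l_a / (X_i - a) = 0 puts p^T phi(X_i) in I for a nonzero phi in
one variable; the linear factors of phi are then traded one by one for powers
of p. *)
Lemma add_root_proper I p i : is_ideal I -> (forall T, ~ I (p ^+ T)) ->
  exists a, forall T, ~ add_root I i a (p ^+ T).
Proof.
move=> idI pI; apply: contrapT => noroot.
have /choice [w wP] : forall a, exists w : nat * {mpoly K[n]},
    I (p ^+ w.1 - w.2 * ('X_i - a%:MP)).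
  move=> a; apply: contrapT => wN; apply: noroot; exists a => T [q Iq].
  by apply: wN; exists (T, q).
have [j jP] := largeK (fun a => choice.pickle ((w a).1, msize (w a).2)).
have [s [us ss ws]] := jP #|{: 'X_{1..n < (odflt (0, 0)%N
  (choice.unpickle j : option (nat * nat))).2}}|.+1.
move: ss; case Ej : (choice.unpickle j) => [[T d]|] /= ss; last first.
  case: s us ss ws => // a s _ _ /= /andP[/eqP ja _].
  by move: Ej; rewrite -ja choice.pickleK.
have {}ws a : a \in s -> (w a).1 = T /\ msize (w a).2 = d.
  by move=> /(allP ws)/eqP ja; move: Ej; rewrite -ja choice.pickleK => -[-> ->].
pose a_ (k : 'I_(size s)) : K := s`_k.
have as_ k : a_ k \in s by rewrite mem_nth.
have [l [k0 lk0] lw] := @nonzero_solution K 'X_{1..n < d} 'I_(size s)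
  (fun m k => (w (a_ k)).2@_m) (ltac:(by rewrite card_ord ss)).
(* The chosen quotients (w a).2 satisfy a linear relation l. *)
have lw0 : \sum_k l k *: (w (a_ k)).2 = 0.
  apply/mpolyP => m; rewrite raddf_sum mcoeff0.
  have [md|dm] := ltnP (mdeg m) d.
    rewrite -[RHS](lw (BMultinom md)); apply: eq_bigr => k _.
    by rewrite /= mcoeffZ mulrC.
  rewrite big1 // => k _ /=; rewrite mcoeffZ memN_msupp_eq0 ?mulr0 //.
  by apply: msize_mdeg_ge; have [_ ->] := ws _ (as_ k).
pose phi : {poly K} := \sum_k l k *: \prod_(k' | k' != k) ('X - (a_ k')%:P).
have a_inj : injective a_.
  by move=> k k' /eqP; rewrite nth_uniq // => /eqP/val_inj.
have phi0 : phi != 0.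
  apply/eqP => /(congr1 (horner^~ (a_ k0))); rewrite horner0 horner_sum.
  rewrite (bigD1 k0) //= [X in _ + X]big1 ?addr0; last first.
    move=> k kk0; rewrite hornerZ horner_prod (bigD1 k0) ?(eq_sym k0) //=.
    by rewrite hornerXsubC subrr mul0r mulr0.
  apply/eqP; rewrite hornerZ horner_prod mulf_neq0 //.
  apply/prodf_neq0 => k kk0; rewrite hornerXsubC subr_eq0.
  by rewrite (inj_eq a_inj) eq_sym.
pose ev (q : {poly K}) : {mpoly K[n]} := (map_poly (@mpolyC n K) q).['X_i].
have evD (q r : {poly K}) : ev (q + r) = ev q + ev r by rewrite /ev rmorphD hornerD.
have evZ c (q : {poly K}) : ev (c *: q) = c *: ev q.
  by rewrite /ev map_polyZ /= hornerZ mul_mpolyC.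
have evM (q r : {poly K}) : ev (q * r) = ev q * ev r by rewrite /ev rmorphM /= hornerM.
have ev1 : ev 1 = 1 by rewrite /ev rmorph1 hornerC.
have evXC a : ev ('X - a%:P) = 'X_i - a%:MP.
  by rewrite /ev rmorphB /= map_polyX map_polyC /= !hornerE.
have Iphi : I (p ^+ T * ev phi).
  rewrite [ev phi](big_morph ev evD (_ : ev 0 = 0)); last first.
    by rewrite /ev rmorph0 horner0.
  rewrite mulr_sumr.
  pose P := ev (\prod_k ('X - (a_ k)%:P)).
  have PE k : P = ('X_i - (a_ k)%:MP) *
      ev (\prod_(k' | k' != k) ('X - (a_ k')%:P)).
    by rewrite /P (bigD1 k) //= evM evXC.
  have -> : \sum_k p ^+ T * ev (l k *: \prod_(k' | k' != k) ('X - (a_ k')%:P)) =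
    \sum_k l k *: ev (\prod_(k' | k' != k) ('X - (a_ k')%:P)) *
       (p ^+ T - (w (a_ k)).2 * ('X_i - (a_ k)%:MP)) +
    P * \sum_k l k *: (w (a_ k)).2.
    rewrite mulr_sumr -big_split; apply: eq_bigr => k _ /=.
    rewrite evZ (PE k) -!mul_mpolyC; ring.
  rewrite lw0 mulr0 addr0; apply: ideal_sum => // k _.
  apply: idealMl => //; have [<- _] := ws _ (as_ k); exact: wP.
have [rs phiE] := closed_field_poly_normal phi.
have {}Iphi : I (p ^+ T * ev (\prod_(z <- rs) ('X - z%:P))).
  have -> : ev (\prod_(z <- rs) ('X - z%:P)) =
      ((lead_coef phi)^-1)%:MP * ev phi.
    rewrite {2}phiE evZ mul_mpolyC scalerA mulVf ?scale1r //.
    by rewrite lead_coef_eq0.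
  by rewrite mulrCA; apply: idealMl.
(* Cancellation of the linear factors of phi. *)
clear -idI pI wP evM ev1 evXC Iphi.
elim: rs T Iphi => [|z rs IHrs] T; first by rewrite big_nil ev1 mulr1; apply: pI.
rewrite big_cons evM evXC => Iz; apply: (IHrs (T + (w z).1)%N).
set P := ev _ in Iz *.
have -> : p ^+ (T + (w z).1) * P = p ^+ T * P *
   (p ^+ (w z).1 - (w z).2 * ('X_i - z%:MP)) +
   (w z).2 * (p ^+ T * (('X_i - z%:MP) * P)) by rewrite exprD; ring.
by apply: idealD => //; apply: idealMl.
Qed.

Lemma ideal_sub_eval I (Q : 'I_n -> K) g : is_ideal I ->
  (forall i, I ('X_i - (Q i)%:MP)) -> I (g - (g.@[Q])%:MP).
Proof.
move=> idI IX; elim/mpolyind: g => [|c m g _ _ IHg].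
  by rewrite meval0 subrr; apply: ideal0.
rewrite mevalD mevalZ mpolyCD opprD addrACA; apply: idealD => //.
rewrite mpolyCM mul_mpolyC -scalerBr -mul_mpolyC; apply: idealMl => //.
rewrite mevalX mpolyXE_id.
elim/big_ind2: _ => [|p' p q' q Ip Iq|i _]; first by rewrite subrr; apply: ideal0.
  have -> : p * q - (p' * q')%:MP =
    q * (p - p'%:MP) + p'%:MP * (q - q'%:MP) by rewrite mpolyCM; ring.
  by apply: idealD => //; apply: idealMl.
by rewrite rmorphXn /= subrXX mulrC; apply: idealMl.
Qed.

(** Specialising the variables one at a time while keeping every power of p out
of the ideal ends at a common zero of I where p does not vanish. *)
Lemma nullstellensatz I p : is_ideal I ->
  (forall Q : 'I_n -> K, (forall g, I g -> g.@[Q] = 0) -> p.@[Q] = 0) ->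
  exists T, I (p ^+ T).
Proof.
move=> idI pV; apply: contrapT => /forallNP pI.
have [J [idJ IJ pJ JX]] : exists J, [/\ is_ideal J, forall g, I g -> J g,
    forall T, ~ J (p ^+ T) &
    forall i, i \in enum 'I_n -> exists a, J ('X_i - a%:MP)].
  elim: (enum _) => [|i s [J [idJ IJ pJ JX]]]; first by exists I.
  have [a aP] := add_root_proper i idJ pJ.
  exists (add_root J i a); split=> //; first exact: add_root_ideal.
    by move=> g Ig; apply: sub_add_root; apply: IJ.
  move=> k; rewrite inE => /predU1P[->|/JX[b Jb]].
    by exists a; apply: add_root_X.
  by exists b; apply: sub_add_root.
have /choice [Q QP] : forall i, exists a, J ('X_i - a%:MP).
  by move=> i; apply: JX; rewrite mem_enum.
have evJ g : J (g - (g.@[Q])%:MP) by apply: ideal_sub_eval.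
have pQ : p.@[Q] = 0.
  apply: pV => g /IJ Jg; apply/eqP/negPn/negP => gQ; apply: (pJ 0%N).
  rewrite expr0 -[1](_ : ((g.@[Q])^-1)%:MP * (g - (g - (g.@[Q])%:MP)) = 1).
    by apply: idealMl => //; apply: idealB.
  by rewrite opprB addrC subrK -mpolyCM mulVf // mpolyC1.
by apply: (pJ 1%N); rewrite expr1; have := evJ p; rewrite pQ mpolyC0 subr0.
Qed.

End Nullstellensatz.

(** * A form of Krull's height theorem *)

Section Height.

Variables (K : fieldType) (p : nat).

(** Membership in the r-th power of the maximal ideal of the origin. *)
Definition order_ge (r : nat) (q : {mpoly K[p]}) :=
  forall m, (mdeg m < r)%N -> q@_m = 0.

Lemma order_geM a b q q' : order_ge a q -> order_ge b q' ->
  order_ge (a + b) (q * q').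
Proof.
move=> qa qb m mab; rewrite mcoeffM big1 // => k /eqP mE.
have [ka|ak] := ltnP (mdeg k.1) a; first by rewrite qa ?mul0r.
rewrite [q'@__]qb ?mulr0 //; have := congr1 mdeg mE; rewrite mdegD => E.
by rewrite -(ltn_add2l a); apply: leq_ltn_trans mab;
  apply: (@leq_trans (mdeg k.1 + mdeg k.2)); rewrite ?leq_add2r // -E.
Qed.

Lemma order_ge0 q : order_ge 0 q. Proof. by []. Qed.

Lemma order_ge1 q : q@_0%MM = 0 -> order_ge 1 q.
Proof. by move=> q0 m; rewrite ltnS leqn0 mdeg_eq0 => /eqP->. Qed.

Lemma order_geMl r q q' : order_ge r q -> order_ge r (q' * q).
Proof. by move=> /(order_geM (@order_ge0 q')). Qed.

Lemma order_geX r q k : order_ge r q -> order_ge (r * k) (q ^+ k).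
Proof.
move=> qr; elim: k => [|k IHk]; first by rewrite muln0.
by rewrite exprS mulnS; apply: order_geM.
Qed.

Lemma order_ge_prod n (F : 'I_n -> {mpoly K[p]}) (a : 'I_n -> nat) :
  (forall i, (F i)@_0%MM = 0) -> order_ge (\sum_i a i) (\prod_i F i ^+ a i).
Proof.
move=> F0; elim/big_ind2: _ => [|r q r' q'|i _]; [by []|exact: order_geM|].
by have := order_geX (k := a i) (order_ge1 (F0 i)); rewrite mul1n.
Qed.

(** Suppose that (F), localised at the origin, contains a power of the maximal
ideal of the p-dimensional space. Every polynomial is then, up to the unit E, a
combination of the products of box monomials of side T with the powers of F, up
to arbitrarily high order: about (p r)^n T^p products account for all
polynomials up to order p r. These are too few to reach the r^p coefficients in
a box of side r once r is large, because n < p. So some nonzero functional L on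
those coefficients kills all the products, hence everything. *)
Lemma height_theorem n (F : 'I_n -> {mpoly K[p]}) E T : (n < p)%N ->
  (forall i, (F i)@_0%MM = 0) -> E@_0%MM != 0 ->
  ~ (forall i, gen_ideal F (E * 'X_i ^+ T)).
Proof.
move=> np F0.
wlog E1 : E / E@_0%MM = 1.
  move=> hE E0 EX; apply: (hE ((E@_0%MM)^-1 *: E)).
  - by rewrite mcoeffZ mulVf.
  - by rewrite mcoeffZ mulVf // oner_eq0.
  - move=> i; rewrite -mul_mpolyC -mulrA.
    exact: (idealMl (gen_ideal_ideal F)).
move=> _ EX.
pose r := (p ^ n * T ^ p).+1; pose R0 := (p * r)%N.
have count : (R0 ^ n * T ^ p < r ^ p)%N.
  apply: (@leq_trans (r ^ n.+1)); last by rewrite leq_pexp2l.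
  rewrite /R0 expnMn [(p ^ n * _)%N]mulnC -mulnA expnSr.
  by rewrite ltn_pmul2l ?expn_gt0.
pose box B (b : {ffun 'I_p -> 'I_B}) := [multinom val (b i) | i < p].
pose Fp (a : 'I_n -> nat) := \prod_i F i ^+ a i.
(* The products to be killed by L: the power of E makes up for the degree of
   the powers of F. *)
pose test (e : {ffun 'I_n -> 'I_R0} * {ffun 'I_p -> 'I_T}) :=
  E ^+ (R0 - \sum_i e.1 i) * 'X_[box _ e.2] * Fp (fun i => e.1 i).
have [l [b0 lb0] ltest] := @nonzero_solution K
  ({ffun 'I_n -> 'I_R0} * {ffun 'I_p -> 'I_T})%type {ffun 'I_p -> 'I_r}
  (fun e b => (test e)@_(box _ b)) (ltac:(
    by rewrite card_prod !card_ffun !card_ord)).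
pose L (q : {mpoly K[p]}) := \sum_b q@_(box r b) * l b.
have L0 : L 0 = 0 by rewrite /L big1 // => b _; rewrite mcoeff0 mul0r.
have LD q q' : L (q + q') = L q + L q'.
  by rewrite /L -big_split; apply: eq_bigr => b _ /=; rewrite mcoeffD mulrDl.
have LZ c q : L (c *: q) = c * L q.
  by rewrite /L mulr_sumr; apply: eq_bigr => b _; rewrite mcoeffZ mulrA.
have Lhigh q : order_ge R0 q -> L q = 0.
  move=> qR; rewrite /L big1 // => b _; rewrite qR ?mul0r // mdegE.
  have p0 : (0 < p)%N by apply: leq_ltn_trans np.
  apply: (@leq_trans (\sum_(i < p) (b i).+1)).
    under [X in (_ <= X)%N]eq_bigr do rewrite -addn1.
    rewrite big_split /= sum1_card card_ord -addn1.
    by under eq_bigr do rewrite mnmE; rewrite leq_add2l.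
  rewrite /R0 -[X in (_ <= X * _)%N]card_ord -sum_nat_const.
  by apply: leq_sum => i _; apply: ltn_ord.
(* Each factor E * X_i ^ T costs one factor E and brings one factor F. *)
have Lmain j : forall q a, (\sum_i a i + j)%N = R0 -> L (E ^+ j * q * Fp a) = 0.
  elim: j => [|j IHj] q a aR.
    by apply: Lhigh; rewrite -aR addn0; apply: order_geMl; apply: order_ge_prod.
  elim/mpolyind: q => [|c m q _ _ IHq]; first by rewrite mulr0 mul0r.
  rewrite mulrDr mulrDl LD IHq addr0 -scalerAr -scalerAl LZ.
  have [mT|/existsNP[i /negP]] := EM (forall i, (m i < T)%N); last first.
    rewrite -leqNgt => Tmi.
    have -> : 'X_[m] = 'X_i ^+ T * 'X_[m - U_(i) *+ T] :> {mpoly K[p]}.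
      rewrite mpolyXn -mpolyXD addmC submK //; apply/mnm_lepP => k.
      by rewrite mulmnE mnm1E; case: eqP => [<-|_]; rewrite ?mul1n ?mul0n.
    have [b bE] := EX i; set X' := 'X_[_ - _].
    have -> : E ^+ j.+1 * ('X_i ^+ T * X') * Fp a =
        \sum_k E ^+ j * (X' * b k) * Fp (fun i => a i + (i == k))%N.
      rewrite (_ : _ * _ = E ^+ j * X' * Fp a * (E * 'X_i ^+ T)); last first.
        by rewrite exprS; ring.
      rewrite bE mulr_sumr; apply: eq_bigr => k _.
      have -> : Fp (fun i => a i + (i == k))%N = Fp a * F k.
        rewrite /Fp; under eq_bigr do rewrite exprD.
        rewrite big_split /=; congr (_ * _).
        rewrite (bigD1 k) //= eqxx expr1 big1 ?mulr1 // => k' /negPf->.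
        by rewrite expr0.
      by ring.
    rewrite (big_morph L LD L0) big1 ?mulr0 // => k _; apply: IHj.
    have delta1 : (\sum_i (i == k) = 1)%N.
      by rewrite (bigD1 k) //= eqxx big1 // => k' /negPf->.
    by rewrite big_split /= delta1 addn1 addSnnS.
  have aR0 i : (a i < R0)%N.
    by rewrite -aR (bigD1 i) //= addnS ltnS -addnA leq_addr.
  have := ltest ([ffun i => Ordinal (aR0 i)], [ffun i => Ordinal (mT i)]).
  rewrite /test /= (_ : box _ _ = m); last first.
    by apply/mnmP => i; rewrite mnmE ffunE.
  rewrite (eq_bigr a) => [|i _]; last by rewrite ffunE.
  rewrite (_ : Fp _ = Fp a); last by apply: eq_bigr => i _; rewrite ffunE.
  by rewrite -aR addKn -/(L _) => ->; rewrite mulr0.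
have LE q : L (E ^+ R0 * q) = 0.
  have := Lmain R0 q (fun _ => 0%N); rewrite big1 // add0n => /(_ erefl).
  by rewrite /Fp big1 ?mulr1 // => i _; rewrite expr0.
(* E is invertible modulo order R0, since 1 - (1 - E) ^ R0 is a multiple of E. *)
have L_eq0 q : L q = 0.
  pose u := (1 - E) ^+ R0.
  have uR : order_ge R0 u.
    have : (1 - E)@_0%MM = 0 by rewrite mcoeffB mcoeff1 eqxx E1 subrr.
    by move=> /order_ge1 /(order_geX (k := R0)); rewrite mul1n.
  have EU : exists U, 1 - u = E * U.
    rewrite /u -[1 in X in X - _](expr1n _ R0) subrXX subKr.
    by eexists.
  have [U EUE] := EU.
  have [V VE] : exists V, (1 - u) ^+ R0 = 1 - u * V.
    exists (\sum_(i < R0) 1 ^+ (R0.-1 - i) * (1 - u) ^+ i).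
    have := subrXX 1 (1 - u) R0; rewrite expr1n subKr => <-.
    by rewrite subKr.
  have -> : q = E ^+ R0 * (U ^+ R0 * q) + (V * q) * u.
    by rewrite mulrA -exprMn -EUE VE; ring.
  by rewrite LD LE Lhigh ?addr0 //; apply: order_geMl.
have := L_eq0 'X_[box r b0]; rewrite /L (bigD1 b0) //= mcoeffX eqxx mul1r.
rewrite big1 ?addr0 => [/eqP|b bb0]; first by rewrite (negPf lb0).
rewrite mcoeffX (_ : (_ == _) = false) ?mul0r //; apply: contraNF bb0 => /eqP.
move=> /mnmP bE; apply/eqP/ffunP => i; apply: val_inj.
by have := bE i; rewrite !mnmE.
Qed.

End Height.

(** * Isolated zeros persist in one-parameter families *)

Lemma gen_ideal_map (S S' : comNzRingType) (h : {rmorphism S -> S'}) n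
  (F : 'I_n -> S) p : gen_ideal F p -> gen_ideal (fun i => h (F i)) (h p).
Proof.
move=> [a ->]; exists (fun i => h (a i)).
by rewrite rmorph_sum; apply: eq_bigr => i _; rewrite rmorphM.
Qed.

Definition pencil (S : comNzRingType) n (f g : 'I_n -> S) (i : 'I_n) : {poly S} :=
  (f i)%:P + 'X * (g i)%:P.

Definition is_zero_set (K : fieldType) n (f : 'I_n -> {mpoly K[n]})
    (A : seq {ffun 'I_n -> K}) :=
  forall Q : {ffun 'I_n -> K}, Q \in A <-> forall i, (f i).@[Q] = 0.

(** With e vanishing at the other zeros of f, e * (X_i - Q_i) vanishes at all of
them, so the Nullstellensatz applies to it. *)
Lemma isolated_zero (K : closedFieldType) n (f : 'I_n -> {mpoly K[n]}) A
    (Q : {ffun 'I_n -> K}) : has_large_fibre K -> is_zero_set f A ->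
  exists e T, e.@[Q] != 0 /\
    forall i, gen_ideal f (e * ('X_i - (Q i)%:MP) ^+ T).
Proof.
move=> largeK fA.
have /choice [d dP] : forall Q' : {ffun 'I_n -> K}, exists i : option 'I_n,
    Q' <> Q -> exists2 k, i = Some k & Q' k != Q k.
  move=> Q'; have [->|/eqP Q'Q] := eqVneq Q' Q; first by exists None.
  have [k Qk] : exists k, Q' k != Q k.
    apply: contrapT => /forallNP Qk; apply: Q'Q; apply/ffunP => k.
    by apply/eqP/negPn/negP.
  by exists (Some k) => _; exists k.
pose e : {mpoly K[n]} := \prod_(Q' <- A | Q' != Q)
  (if d Q' is Some k then 'X_k - (Q' k)%:MP else 1).
have eQ : e.@[Q] != 0.
  rewrite rmorph_prod /= prodf_seq_neq0; apply/allP => Q' _.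
  apply/implyP => /eqP /dP[k -> Qk].
  by rewrite mevalB mevalXU mevalC subr_eq0 eq_sym.
have eA Q' : Q' \in A -> Q' != Q -> e.@[Q'] = 0.
  move=> Q'A Q'Q; rewrite /e (big_rem Q') //= Q'Q.
  have [k -> _] := dP _ (elimN eqP Q'Q).
  by rewrite mevalM mevalB mevalXU mevalC subrr mul0r.
have /choice [T TP] : forall i, exists T,
    gen_ideal f ((e * ('X_i - (Q i)%:MP)) ^+ T).
  move=> i; apply: (nullstellensatz largeK); first exact: gen_ideal_ideal.
  move=> Q1 fQ1; pose Q' := [ffun i => Q1 i].
  have QQ p : p.@[Q1] = p.@[Q'] by apply: meval_eq => k; rewrite ffunE.
  rewrite QQ mevalM; have [->|Q'Q] := eqVneq Q' Q.
    by rewrite mevalB mevalXU mevalC subrr mulr0.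
  rewrite eA ?mul0r //; apply/fA => k; rewrite -QQ; apply: fQ1.
  exact: gen_ideal_gen.
pose T0 := (\sum_i T i)%N.
exists (e ^+ T0), T0; split=> [|i]; first by rewrite rmorphXn expf_neq0.
rewrite -exprMn (_ : T0 = T0 - T i + T i)%N; last first.
  by rewrite subnK // /T0 (bigD1 i) //= leq_addr.
by rewrite exprD; apply: (idealMl (gen_ideal_ideal f)).
Qed.

Section Persistence.

Variables (K : fieldType) (n : nat) (f g : 'I_n -> {mpoly K[n]}).
Variables (Q : {ffun 'I_n -> K}) (e : {mpoly K[n]}) (T : nat).
Hypothesis fQ : forall i, (f i).@[Q] = 0.
Hypothesis eQ : e.@[Q] != 0.
Hypothesis eT : forall i, gen_ideal f (e * ('X_i - (Q i)%:MP) ^+ T).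

Let shift (i : 'I_n) : {mpoly K[n.+1]} :=
  'X_(widen_ord (leqnSn n) i) + (Q i)%:MP.

Let base : {rmorphism {mpoly K[n]} -> {mpoly K[n.+1]}} :=
  GRing.RMorphism.clone _ _ (mmap (@mpolyC n.+1 K) shift) _.

Let psi : {rmorphism {poly {mpoly K[n]}} -> {mpoly K[n.+1]}} :=
  GRing.RMorphism.clone _ _ (horner_eval 'X_ord_max \o map_poly base) _.

Let psiE p : psi p = (map_poly base p).['X_ord_max]. Proof. by []. Qed.

Let psiC p : psi p%:P = base p.
Proof. by rewrite psiE map_polyC hornerC. Qed.

Let psiX : psi 'X = 'X_ord_max.
Proof. by rewrite psiE map_polyX hornerX. Qed.

Let baseX i : base ('X_i - (Q i)%:MP) = 'X_(widen_ord (leqnSn n) i).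
Proof.
by rewrite rmorphB /= mmapX mmapC mmap1U addrK.
Qed.

Let base0 p : (base p)@_0%MM = p.@[Q].
Proof.
elim/mpolyind: p => [|c m p _ _ IHp]; first by rewrite !rmorph0.
rewrite rmorphD mcoeffD IHp mevalD; congr (_ + _).
rewrite /= mmapZ mmapX mevalZ mevalX mul_mpolyC mcoeffZ; congr (_ * _).
rewrite rmorph_prod /=; apply: eq_bigr => i _; rewrite rmorphXn /=; congr (_ ^+ _).
by rewrite mcoeffD mcoeffC eqxx mulr1 mcoeffX mnm1_eq0 add0r.
Qed.

Let psi0 q : (psi q)@_0%MM = (q.[0]).@[Q].
Proof.
have -> : q.[0].@[Q] = ((map_poly base q).[0])@_0%MM.
  by rewrite -base0 -[in RHS](rmorph0 base) horner_map.
rewrite psiE -!(horner_map (mcoeff 0%MM)) /=.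
by rewrite mcoeffX mnm1_eq0 mcoeff0.
Qed.

(** If q did not vanish at (Q, s = 0), it would be a unit there, and s^j q
would put a power of s in the localised ideal of the pencil. Modulo s that
ideal contains powers of the X_i - Q_i because Q is an isolated zero of f. The
n members of the pencil would thus generate a primary ideal at a point of the
(n + 1)-dimensional space of (X, s), against the height theorem. *)
Lemma persistence j (q : {poly {mpoly K[n]}}) :
  gen_ideal (pencil f g) ('X^j * q) -> (q.[0]).@[Q] = 0.
Proof.
move=> Jq; apply/eqP/negPn/negP => qQ.
have idJ := gen_ideal_ideal (pencil f g).
apply: (@height_theorem K n.+1 n (fun i => psi (pencil f g i))
  (psi (q * (e ^+ j)%:P)) (T * j + j)) => //.
- by move=> i; rewrite psi0 /pencil !hornerE.
- by rewrite psi0 hornerM hornerC mevalM rmorphXn mulf_neq0 ?expf_neq0.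
move=> i'; have [i'n|ni'] := ltnP i' n; last first.
  have -> : i' = ord_max by apply: val_inj; apply/eqP; rewrite eqn_leq -ltnS ltn_ord.
  rewrite -psiX -rmorphXn -rmorphM; apply: gen_ideal_map.
  rewrite exprD; set u := (e ^+ j)%:P.
  rewrite (_ : _ * _ = 'X ^+ (T * j) * u * ('X^j * q)); last first.
    by rewrite [RHS]mulrACA mulrC [q * u]mulrC.
  exact: idealMl.
have -> : i' = widen_ord (leqnSn n) (Ordinal i'n) by apply: val_inj.
set i := Ordinal i'n; rewrite -baseX -psiC -rmorphXn -rmorphM.
apply: gen_ideal_map; set x := ('X_i - _)%:P.
have [a aE] := eT i.
pose b := \sum_k (a k)%:P * pencil f g k; pose c := \sum_k (a k)%:P * (g k)%:P.
have Jb : gen_ideal (pencil f g) b by exists (fun k => (a k)%:P).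
have yE : e%:P * x ^+ T = b - 'X * c.
  rewrite /x -rmorphXn -rmorphM /= aE rmorph_sum /b /c mulr_sumr -sumrB.
  by apply: eq_bigr => k _; rewrite rmorphM /= /pencil; ring.
have -> : q * (e ^+ j)%:P * x ^+ (T * j + j) = x ^+ j * (q * (e%:P * x ^+ T) ^+ j).
  by rewrite exprD exprM exprMn rmorphXn /= [RHS]mulrC !mulrA.
apply: (idealMl idJ); rewrite yE.
have -> : q * (b - 'X * c) ^+ j =
    q * ((b - 'X * c) ^+ j - (- ('X * c)) ^+ j) + (- c) ^+ j * ('X^j * q).
  have -> : (- c) ^+ j * ('X^j * q) = q * (- ('X * c)) ^+ j.
    by rewrite -mulrN exprMn [RHS]mulrCA [LHS]mulrCA [q * _]mulrC.
  by rewrite mulrBr subrK.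
apply: (idealD idJ); last exact: idealMl.
apply: (idealMl idJ); rewrite subrXX opprK subrK.
rewrite mulrC; exact: (idealMl idJ).
Qed.

End Persistence.

(** * The pencil spanned by a system and a system of pure powers *)

Lemma msizeM_leq (K : fieldType) n (p q : {mpoly K[n]}) a b :
  (msize p <= a.+1)%N -> (msize q <= b.+1)%N -> (msize (p * q) <= (a + b).+1)%N.
Proof.
move=> pa qb; have [->|p0] := eqVneq p 0; first by rewrite mul0r msize0.
have [->|q0] := eqVneq q 0; first by rewrite mulr0 msize0.
rewrite msizeM //; have := leq_add pa qb; rewrite addSn addnS.
by case: (msize p + msize q)%N.
Qed.

Lemma msizeX_leq (K : fieldType) n (p : {mpoly K[n]}) i :
  (msize p <= 2)%N -> (msize (p ^+ i) <= i.+1)%N.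
Proof.
move=> p2; elim: i => [|i IHi]; first by rewrite expr0 msize1.
by rewrite exprS -[i.+1]add1n; apply: msizeM_leq.
Qed.

(** Macaulay's reduction at s = oo. In degree at most N, multiples of the
members of the pencil rewrite s X^m, for a non-standard monomial X^m, as
- X^(m - k_i U_i) f_i, which has no larger degree. In the monomial basis this
is a matrix s I - C with C constant, so its determinant, the characteristic
polynomial of C, is not zero; the adjugate matrix expresses its multiples of
all monomials through the standard ones. *)
Section PencilRelation.

Variables (K : fieldType) (n : nat) (k : 'I_n -> nat).
Variables (f : 'I_n -> {mpoly K[n]}).
Hypothesis k_gt0 : forall i, (0 < k i)%N.
Hypothesis fk : forall i, (msize (f i) <= (k i).+1)%N.

Let N := (\prod_i k i)%N.
Local Notation mon := 'X_{1..n < N.+1}.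
Let J := gen_ideal (pencil f (fun i => 'X_i ^+ k i)).
Let kap : {poly K} -> {poly {mpoly K[n]}} := map_poly (@mpolyC n K).
Let std (m : mon) := [forall i, m i < k i]%N.

Lemma card_standard : (#|std| <= N)%N.
Proof.
apply: (@leq_trans #|{dffun forall i, 'I_(k i)}|); last first.
  apply/eq_leq; rewrite card_dep_ffun foldrE big_image /=.
  by apply: eq_bigr => i _; rewrite card_ord.
pose F (m : mon) : {dffun forall i, 'I_(k i)} :=
  finfun (fun i => insubd (Ordinal (k_gt0 i)) (m i)).
apply: (@leq_card_in _ _ F) => m m' /forallP mk /forallP mk' /ffunP FF.
apply: val_inj; apply/mnmP => i; have := FF i; rewrite !ffunE => /(congr1 val).
by rewrite !val_insubd mk mk'.
Qed.

Let red (m : mon) : {mpoly K[n]} :=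
  if [pick i | (k i <= m i)%N] is Some i then 'X_[m - U_(i) *+ k i] * f i else 0.

Let msize_red m : (msize (red m) <= N.+1)%N.
Proof.
rewrite /red; case: pickP => [i kmi|_]; last by rewrite msize0.
have km : (U_(i) *+ k i <= m)%MM.
  apply/mnm_lepP => j; rewrite mulmnE mnm1E.
  by case: eqP => [<-|_]; rewrite ?mul1n ?mul0n.
apply: leq_trans (msizeM_leq (a := mdeg (m - U_(i) *+ k i)) _ (fk i)) _.
  by rewrite msizeX.
rewrite -[in X in (_ + X)%N](mul1n (k i)) -(mdeg1 i) -mdegMn -mdegD submK //.
exact: bmdeg.
Qed.

Let mv (a : 'I_#|{: mon}|) : mon := enum_val a.

Let mvK m : mv (enum_rank m) = m.
Proof. exact: enum_rankK. Qed.

Let mv_bij : bijective mv.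
Proof. exact: enum_val_bij. Qed.

Let C : 'M[K]_#|{: mon}| := - \matrix_(a, b) (red (mv a))@_(mv b).
Let delta := char_poly C.

Let delta_neq0 : delta != 0.
Proof. exact/monic_neq0/char_poly_monic. Qed.

Let row_red a : \sum_b kap (char_poly_mx C a b) * ('X_[mv b])%:P =
  'X * ('X_[mv a])%:P + (red (mv a))%:P.
Proof.
transitivity (\sum_b ((a == b)%:R * 'X * ('X_[mv b])%:P +
   ((red (mv a))@_(mv b) *: 'X_[mv b])%:P)).
  apply: eq_bigr => b _; rewrite !mxE polyCN opprK /kap rmorphD /= mulrDl.
  rewrite map_polyC /= rmorphMn /= map_polyX -mul_mpolyC -polyCM.
  by rewrite mulr_natl.
rewrite big_split /=; congr (_ + _).
  rewrite (bigD1 a) //= eqxx mul1r big1 ?addr0 // => b /negPf.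
  by rewrite eq_sym => ->; rewrite !mul0r.
rewrite -rmorph_sum /=; congr (_%:P).
rewrite [RHS](mpolywE (msize_red _)).
by rewrite (reindex _ (onW_bij _ mv_bij)).
Qed.

Let row_red_mod a : J (\sum_b kap (char_poly_mx C a b) * ('X_[mv b])%:P -
  (std (mv a))%:R * 'X * ('X_[mv a])%:P).
Proof.
rewrite row_red /red; set m := mv a.
case: pickP => [i kmi|mk].
  have -> : std m = false by apply/forallP => /(_ i); rewrite ltnNge kmi.
  rewrite mul0r mul0r subr0.
  have -> : 'X_[m] = 'X_[m - U_(i) *+ k i] * 'X_i ^+ k i :> {mpoly K[n]}.
    rewrite mpolyXn -mpolyXD submK //; apply/mnm_lepP => j; rewrite mulmnE mnm1E.
    by case: eqP => [<-|_]; rewrite ?mul1n ?mul0n.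
  set Y := 'X_[_ - _]; rewrite (_ : _ + _ = Y%:P * pencil f (fun i => 'X_i ^+ k i) i).
    exact: idealMl (gen_ideal_ideal _) _ _ (gen_ideal_gen _ _).
  by rewrite /pencil !rmorphM /=; ring.
have -> : std m by apply/forallP => i; rewrite ltnNge mk.
by rewrite mul1r addr0 subrr; apply: ideal0; apply: gen_ideal_ideal.
Qed.

Let mon_mod : exists r : mon -> mon -> {poly K}, forall m : mon,
  J (kap delta * ('X_[m])%:P - \sum_(m' | std m') kap (r m m') * ('X_[m'])%:P).
Proof.
pose adj := \adj (char_poly_mx C).
exists (fun m m' => adj (enum_rank m) (enum_rank m') * 'X) => m.
set a := enum_rank m.
rewrite (_ : _ - _ = \sum_b kap (adj a b) *
  (\sum_c kap (char_poly_mx C b c) * ('X_[mv c])%:P -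
  (std (mv b))%:R * 'X * ('X_[mv b])%:P)).
  apply: ideal_sum => [|b _]; first exact: gen_ideal_ideal.
  exact: idealMl (gen_ideal_ideal _) _ _ (row_red_mod b).
under [RHS]eq_bigr do rewrite mulrBr mulr_sumr.
rewrite sumrB; congr (_ - _).
  rewrite exchange_big /= (bigD1 a) //= [X in _ + X]big1 ?addr0.
    under eq_bigr do rewrite mulrA -rmorphM /=.
    rewrite -mulr_suml -rmorph_sum /=.
    have /matrixP/(_ a a) := mul_adj_mx (char_poly_mx C); rewrite !mxE eqxx => ->.
    by rewrite /a mvK.
  move=> c ca; under eq_bigr do rewrite mulrA -rmorphM /=.
  rewrite -mulr_suml -rmorph_sum /=.
  have /matrixP/(_ a c) := mul_adj_mx (char_poly_mx C); rewrite !mxE eq_sym.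
  by rewrite (negPf ca) => ->; rewrite rmorph0 mul0r.
rewrite [RHS](reindex _ (onW_bij _ (@enum_rank_bij mon))) /= big_mkcond /=.
apply: eq_bigr => m' _; rewrite mvK; case: (std m').
  by rewrite mul1r /kap rmorphM /= map_polyX mulrA.
by rewrite !mul0r mulr0.
Qed.

(** The multiples by the characteristic polynomial of the N + 1 powers of h lie
in the K[s]-module spanned by at most N standard monomials, modulo the ideal of
the pencil. *)
Lemma pencil_relation (h : {mpoly K[n]}) : (msize h <= 2)%N ->
  exists (d : {poly K}) (phi : 'I_N.+1 -> {poly K}),
  [/\ d != 0, exists i, phi i != 0 &
    J (kap d * \sum_i kap (phi i) * (h ^+ i)%:P)].
Proof.
move=> h2; have [r rP] := mon_mod.
pose c (i : 'I_N.+1) m' := \sum_(m : mon) ((h ^+ i)@_m)%:P * r m m'.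
have cP (i : 'I_N.+1) : J (kap delta * (h ^+ i)%:P -
    \sum_(m' | std m') kap (c i m') * ('X_[m'])%:P).
  rewrite (_ : _ - _ = \sum_(m : mon) ((h ^+ i)@_m)%:MP%:P *
    (kap delta * ('X_[m])%:P - \sum_(m' | std m') kap (r m m') * ('X_[m'])%:P)).
    apply: ideal_sum => [|m _]; first exact: gen_ideal_ideal.
    exact: idealMl (gen_ideal_ideal _) _ _ (rP m).
  under [RHS]eq_bigr do rewrite mulrBr.
  rewrite sumrB; congr (_ - _).
    have hi : (msize (h ^+ i) <= N.+1)%N by apply: leq_trans (msizeX_leq i h2) _.
    rewrite [in LHS](mpolywE hi) rmorph_sum mulr_sumr /=; apply: eq_bigr => m _.
    by rewrite -mul_mpolyC rmorphM mulrCA.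
  under [RHS]eq_bigr do rewrite mulr_sumr.
  rewrite exchange_big /=; apply: eq_bigr => m' _.
  rewrite /c /kap rmorph_sum mulr_suml; apply: eq_bigr => m _.
  by rewrite rmorphM /= map_polyC /= mulrA.
pose stds := enum std.
have stdsN : (size stds <= N)%N by rewrite -cardE card_standard.
pose R : 'M[{poly K}]_N.+1 := \matrix_(i, j)
  if (j < size stds)%N then c i (nth (@bm0 n N) stds j) else 0.
have /det0P[v v0 vR] : \det R == 0.
  rewrite (expand_det_col _ ord_max) big1 // => i _.
  by rewrite mxE /= ltnNge stdsN mul0r.
exists delta, (v 0); split=> //; first exact/rV0Pn.
rewrite (_ : _ * _ = \sum_i kap (v 0 i) * (kap delta * (h ^+ i)%:P -
    \sum_(m' | std m') kap (c i m') * ('X_[m'])%:P)).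
  apply: ideal_sum => [|m _]; first exact: gen_ideal_ideal.
  exact: idealMl (gen_ideal_ideal _) _ _ (cP m).
under [RHS]eq_bigr do rewrite mulrBr mulr_sumr.
rewrite sumrB exchange_big /= [X in _ - X]big1 ?subr0 => [|m' stdm'].
  by rewrite mulr_sumr; apply: eq_bigr => i _; rewrite mulrCA.
under eq_bigr do rewrite mulrA -rmorphM.
rewrite -mulr_suml -rmorph_sum /=.
have m'j : (index m' stds < size stds)%N by rewrite index_mem mem_enum.
have jN : (index m' stds < N.+1)%N by rewrite ltnS ltnW // (leq_trans m'j).
have Rc i : R i (Ordinal jN) = c i m'.
  by rewrite mxE /= m'j nth_index ?mem_enum.
have -> : \sum_i v 0 i * c i m' = 0.
  have /rowP/(_ (Ordinal jN)) := vR; rewrite !mxE => vRj; rewrite -[RHS]vRj.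
  by apply: eq_bigr => i _; rewrite Rc.
by rewrite rmorph0 mul0r.
Qed.

End PencilRelation.

(** * Too many zeros when one of them is multiple *)

Section SeparatingForm.

Variables (K : closedFieldType) (n : nat).

Definition dotf (c v : 'I_n -> K) := \sum_j c j * v j.

(** The form with coefficients a^j kills v only if a is a root of the
polynomial with coefficients v. *)
Lemma avoiding_form (vs : seq ('I_n -> K)) :
  (forall i, (i < size vs)%N -> exists j, nth (fun _ => 0) vs i j != 0) ->
  exists c, forall i, (i < size vs)%N -> dotf c (nth (fun _ => 0) vs i) != 0.
Proof.
move=> vs0.
pose q i : {poly K} := \sum_(j < n) nth (fun _ => 0) vs i j *: 'X^j.
have q0 i : (i < size vs)%N -> q i != 0.
  move=> /vs0[j]; apply: contraNneq => /(congr1 (fun p : {poly K} => p`_j)).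
  rewrite coef0 /q coef_sum (bigD1 j) //= coefZ coefXn eqxx mulr1.
  rewrite big1 ?addr0 => [->//|k kj]; rewrite coefZ coefXn.
  by rewrite (_ : (_ == _) = false) ?mulr0 // eq_sym; apply: negPf.
have : \prod_(i < size vs) q i != 0 by apply/prodf_neq0 => i _; apply: q0.
move=> /closed_nonrootP[a]; rewrite rootE horner_prod => /prodf_neq0 aP.
exists (fun j => a ^+ j) => i ivs; have := aP (Ordinal ivs) isT.
apply: contra_neq => <-; rewrite horner_sum; apply: eq_bigr => j _.
by rewrite !hornerE mulrC.
Qed.

End SeparatingForm.

Lemma strip_common_power (K : fieldType) (I : finType) (phi : I -> {poly K}) :
  (exists i, phi i != 0) -> exists a (psi : I -> {poly K}),
    (forall i, phi i = 'X^a * psi i) /\ exists i, (psi i).[0] != 0.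
Proof.
move=> [i0]; have [s] := ubnP (size (phi i0)).
elim: s phi => // s IHs phi; rewrite ltnS => phis phi0.
have [[i phii]|phi00] := EM (exists i, (phi i).[0] != 0).
  exists 0%N, phi; split; last by exists i.
  by move=> j; rewrite expr0 mul1r.
have /choice [psi psiE] : forall i, exists q, phi i = q * 'X.
  move=> i; have : root (phi i) 0.
    by apply/negPn/negP => h; apply: phi00; exists i.
  by move=> /factor_theorem[q ->]; exists q; rewrite subr0.
have psi0 : psi i0 != 0.
  by apply: contra_neq phi0 => p0; rewrite psiE p0 mul0r.
have [|a [chi [chiE chi0]]] := IHs psi _ psi0.
  by apply: leq_trans phis; rewrite psiE size_mulX.
exists a.+1, chi; split=> // i.
by rewrite psiE chiE exprSr -!mulrA ['X * _]mulrC.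
Qed.

(** Restriction of p to the line through Q with direction v. It is divisible by
['X^2] exactly when p and its derivative along v vanish at Q. *)
Definition along (K : fieldType) n (Q v : 'I_n -> K) (p : {mpoly K[n]}) :
  {poly K} := mmap polyC (fun j => (Q j)%:P + v j *: 'X) p.

HB.instance Definition _ (K : fieldType) n (Q v : 'I_n -> K) :=
  GRing.RMorphism.copy (@along K n Q v)
    (mmap polyC (fun j => (Q j)%:P + v j *: 'X)).

Section Along.

Variables (K : fieldType) (n : nat) (Q v : 'I_n -> K).

Lemma alongC c : along Q v c%:MP = c%:P.
Proof. exact: mmapC. Qed.

Lemma alongX i : along Q v 'X_i = (Q i)%:P + v i *: 'X.
Proof. by rewrite /along mmapX mmap1U. Qed.

Lemma horner_along a p : (along Q v p).[a] = p.@[fun j => Q j + v j * a].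
Proof.
elim/mpolyind: p => [|c m p _ _ IHp]; first by rewrite !rmorph0 horner0.
rewrite !rmorphD hornerD IHp; congr (_ + _).
rewrite /= /along mmapZ mmapX mevalZ mevalX hornerM hornerC; congr (_ * _).
rewrite horner_prod; apply: eq_bigr => i _; rewrite horner_exp.
by rewrite hornerD hornerC hornerZ hornerX.
Qed.

Lemma along0 p : (along Q v p).[0] = p.@[Q].
Proof.
by rewrite horner_along; apply: meval_eq => j; rewrite mulr0 addr0.
Qed.

Lemma size_along p : (size (along Q v p) <= msize p)%N.
Proof.
rewrite /along /mmap; apply: leq_trans (size_sum _ _ _) _.
apply/bigmax_leqP_seq => m mp _; apply: leq_trans (msize_mdeg_lt mp).
rewrite mul_polyC; apply: leq_trans (size_scale_leq _ _) _; rewrite /mmap1 mdegE.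
elim/big_ind2: _ => [|p1 d1 p2 d2 p1d p2d|i _]; first by rewrite size_poly1.
  apply: leq_trans (size_polyMleq _ _) _.
  have := leq_add p1d p2d; rewrite addSn addnS.
  by case: (size p1 + size p2)%N.
elim: (m i) => [|j IHj]; first by rewrite expr0 size_poly1.
rewrite exprS; apply: leq_trans (size_polyMleq _ _) _.
have l2 : (size ((Q i)%:P + v i *: 'X : {poly K})%R <= 2)%N.
  rewrite (leq_trans (size_polyD _ _)) // geq_max (leq_trans (size_polyC_leq1 _)) //.
  by rewrite (leq_trans (size_scale_leq _ _)) // size_polyX.
have := leq_add l2 IHj; rewrite addSn.
by case: (size _ + size _)%N.
Qed.

End Along.

Lemma dvdp_ideal (K : fieldType) (d : {poly K}) :
  is_ideal (fun p : {poly K} => d %| p).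
Proof.
split=> [|p q dp dq|a p dp]; [exact: dvdp0|exact: dvdp_add|].
exact: dvdp_mull.
Qed.

Lemma coefs_ideal (S : comNzRingType) (I : S -> Prop) : is_ideal I ->
  is_ideal (fun P : {poly S} => forall j, I P`_j).
Proof.
move=> idI; split=> [j|P R IP IR j|A P IP j].
- by rewrite coef0; apply: ideal0.
- by rewrite coefD; apply: idealD.
- by rewrite coefM; apply: ideal_sum => // i _; apply: idealMl.
Qed.

(** Both the f_i and the powers X_i^(k_i) are divisible by ['X^2] along the
tangent line, hence so are the coefficients of all elements of the ideal of the
pencil. As h restricts to ['X] on that line, the relation between the powers of
h has no term in 1 and h: this is the double root. *)
Lemma double_zero_bound_normal (K : closedFieldType) n (k : 'I_n -> nat)
    (f : 'I_n -> {mpoly K[n]}) (A : seq {ffun 'I_n -> K}) (i0 : 'I_n) :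
  has_large_fibre K -> (forall i, 0 < k i)%N -> (2 <= k i0)%N ->
  (forall i, msize (f i) <= (k i).+1)%N ->
  (forall i, 'X^2 %| along (fun _ => 0) (fun j => (j == i0)%:R) (f i)) ->
  is_zero_set f A -> uniq A -> (size A < \prod_i k i)%N.
Proof.
move=> largeK k0 k2 fk ftan fA uA.
set N := (\prod_i k i)%N; pose L := along (fun _ : 'I_n => 0 : K) (fun j => (j == i0)%:R).
have N2 : (2 <= N)%N.
  rewrite /N (bigD1 i0) //=; apply: leq_trans k2 _; apply: leq_pmulr.
  by rewrite prodn_cond_gt0.
pose g i : {mpoly K[n]} := 'X_i ^+ k i.
have gtan i : 'X^2 %| L (g i).
  rewrite /L /g rmorphXn /= alongX polyC0 add0r.
  have [->|ii0] := eqVneq i i0; first by rewrite scale1r dvdp_exp2l.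
  by rewrite scale0r expr0n (gtn_eqF (k0 i)) dvdp0.
pose O : {ffun 'I_n -> K} := [ffun _ => 0].
have OA : O \in A.
  apply/fA => i; rewrite (@meval_eq _ _ O (fun _ => 0)); last by move=> j; rewrite ffunE.
  rewrite -(along0 _ (fun j => (j == i0)%:R)).
  by have /dvdpP[q ->] := ftan i; rewrite hornerM hornerXn expr0n mulr0.
(* A linear form h separating the points of A, scaled so that h restricts to
   the coordinate on the tangent line. *)
pose vs : seq ('I_n -> K) := (fun j => (j == i0)%:R) ::
  [seq (fun j => P.1 j - P.2 j) | P : {ffun 'I_n -> K} * {ffun 'I_n -> K}
     <- [seq (P, P') | P <- A, P' <- A] & P.1 != P.2].
have [c cP] : exists c : 'I_n -> K, c i0 = 1 /\
    forall P P', P \in A -> P' \in A -> dotf c P = dotf c P' -> P = P'.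
  have [i|c cv] := @avoiding_form K n vs.
    case: i => [_|i] /=; first by exists i0; rewrite eqxx oner_neq0.
    rewrite ltnS size_map => ivs.
    rewrite (nth_map (O, O)) //.
    set P := nth _ _ i.
    have : P \in [seq P <- [seq (P, P') | P <- A, P' <- A] | P.1 != P.2].
      exact: mem_nth.
    rewrite mem_filter => /andP[P12 _].
    apply: contrapT => /forallNP h; move/negP: P12; apply; apply/eqP/ffunP => j.
    by apply/eqP; rewrite -subr_eq0; apply/negPn/negP.
  have ci0 : c i0 != 0.
    have := cv 0%N isT; rewrite /= /dotf (bigD1 i0) //= eqxx mulr1 big1 ?addr0 //.
    by move=> j /negPf->; rewrite mulr0.
  exists (fun j => (c i0)^-1 * c j); split; first by rewrite mulVf.
  move=> P P' PA PA' PP; apply/eqP/negPn/negP => P12.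
  have : (P, P') \in [seq P <- [seq (P, P') | P <- A, P' <- A] | P.1 != P.2].
    by rewrite mem_filter P12 allpairs_f.
  move=> /(nthP (O, O))[i ivs iE].
  have := cv i.+1; rewrite /= ltnS size_map (nth_map (O, O)) // iE /= => /(_ ivs).
  apply/negP/negPn/eqP; rewrite /dotf; under eq_bigr do rewrite mulrBr.
  rewrite sumrB; apply/eqP; rewrite subr_eq0; apply/eqP.
  apply: (mulfI (invr_neq0 ci0)); rewrite !mulr_sumr.
  under eq_bigr do rewrite mulrA; under [RHS]eq_bigr do rewrite mulrA.
  exact: PP.
have [ci0 csep] := cP.
pose h : {mpoly K[n]} := \sum_j c j *: 'X_j.
have hE P : h.@[P] = dotf c P.
  by rewrite /h rmorph_sum /=; apply: eq_bigr => j _; rewrite mevalZ mevalXU.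
have hO : h.@[O] = 0.
  by rewrite hE /dotf big1 // => j _; rewrite ffunE mulr0.
have h2 : (msize h <= 2)%N.
  apply: leq_trans (msize_sum _ _ _) _; apply/bigmax_leqP => j _.
  by apply: leq_trans (msizeZ_le _ _) _; rewrite msizeX mdeg1.
have Lh : L h = 'X.
  rewrite /h /L rmorph_sum (bigD1 i0) //= big1 ?addr0 => [|j ji0];
    rewrite -mul_mpolyC rmorphM /= alongC alongX polyC0 add0r.
    by rewrite eqxx ci0 scale1r mul1r.
  by rewrite (negPf ji0) scale0r mulr0.
have [d [phi [d0 phi0 JP]]] := pencil_relation k0 fk h2.
(* The terms in 1 and h of the relation vanish identically in s. *)
have phi_low (t : 'I_N.+1) : (t < 2)%N -> phi t = 0.
  move=> t2; apply/(mulfI d0)/polyP => j; rewrite mulr0 coef0.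
  have : 'X^2 %| L (map_poly (@mpolyC n K) d *
      \sum_i map_poly (@mpolyC n K) (phi i) * (h ^+ i)%:P)`_j.
    move: j; apply: (@gen_ideal_sub _ _ _
      (fun P : {poly {mpoly K[n]}} => forall j, 'X^2 %| L P`_j) _ _ _ JP).
      exact: (coefs_ideal (preim_ideal (along _ _) (dvdp_ideal 'X^2))).
    move=> i [|j]; rewrite /pencil coefD coefC coefXM /= ?addr0 //.
    rewrite add0r coefC; case: j => [|j] /=; first exact: gtan.
    by rewrite /L rmorph0 dvdp0.
  have -> : (map_poly (@mpolyC n K) d *
      \sum_i map_poly (@mpolyC n K) (phi i) * (h ^+ i)%:P)`_j =
      \sum_i ((d * phi i)`_j)%:MP * h ^+ i.
    rewrite mulr_sumr coef_sum; apply: eq_bigr => i _.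
    by rewrite mulrA -rmorphM coefMC coef_map.
  rewrite /L rmorph_sum => /dvdpP[q /(congr1 (fun p : {poly K} => p`_t))].
  rewrite coefMXn t2 coef_sum (bigD1 t) //= [X in _ + X]big1 ?addr0 => [|i it];
    rewrite rmorphM rmorphXn /= alongC -/(L h) Lh coefCM coefXn.
    by rewrite eqxx mulr1.
  by rewrite (_ : (_ == _) = false) ?mulr0 // eq_sym; apply: negPf.
have [a [psi [psiE [i1 psi0]]]] := strip_common_power phi0.
have [b [d' [dE [u1 d'0]]]] := @strip_common_power K 'I_1 (fun _ => d)
  (ex_intro _ ord0 d0).
pose Phi : {poly K} := \sum_i (psi i).[0] *: 'X^i.
have coefPhi (i : 'I_N.+1) : Phi`_i = (psi i).[0].
  rewrite /Phi coef_sum (bigD1 i) //= coefZ coefXn eqxx mulr1.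
  rewrite [X in _ + X]big1 ?addr0 //.
  move=> j ji; rewrite coefZ coefXn (_ : (_ == _) = false) ?mulr0 //.
  by rewrite eq_sym; apply: negPf.
have Phi0 : Phi != 0.
  by apply: contra_neq psi0 => P0; rewrite -coefPhi P0 coef0.
have sPhi : (size Phi <= N.+1)%N.
  apply: leq_trans (size_sum _ _ _) _; apply/bigmax_leqP => i _.
  by apply: leq_trans (size_scale_leq _ _) _; rewrite size_polyXn.
have rootPhi P : P \in A -> root Phi h.@[P].
  move=> PA; have [e [T [eP eT]]] := @isolated_zero K n f A P largeK fA.
  have fP i : (f i).@[P] = 0 by apply: (fA P).1.
  have := @persistence K n f g P e T fP eP eT (b + a)
    (map_poly (@mpolyC n K) (d' u1) *
     \sum_i map_poly (@mpolyC n K) (psi i) * (h ^+ i)%:P).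
  have -> : 'X^(b + a) * (map_poly (@mpolyC n K) (d' u1) *
     \sum_i map_poly (@mpolyC n K) (psi i) * (h ^+ i)%:P) =
     map_poly (@mpolyC n K) d * \sum_i map_poly (@mpolyC n K) (phi i) * (h ^+ i)%:P.
    rewrite (dE u1) rmorphM /= map_polyXn exprD -!mulrA; congr (_ * _).
    rewrite mulrCA; congr (_ * _); rewrite mulr_sumr; apply: eq_bigr => i _.
    by rewrite psiE rmorphM /= map_polyXn mulrA.
  move=> /(_ JP); rewrite hornerM mevalM.
  have ev0 (p : {poly K}) : ((map_poly (@mpolyC n K) p).[0]).@[P] = p.[0].
    by rewrite -[0 in LHS](rmorph0 (@mpolyC n K)) horner_map mevalC.
  rewrite ev0 => /eqP; rewrite mulf_eq0 (negPf d'0) /= => /eqP E.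
  apply/eqP; rewrite -[RHS]E /Phi !horner_sum [in RHS]rmorph_sum /=.
  apply: eq_bigr => i _.
  by rewrite hornerZ hornerXn hornerM hornerC mevalM ev0 rmorphXn.
pose Psi := drop_poly 2 Phi.
have PhiE : Phi = Psi * 'X^2.
  rewrite -[LHS](poly_take_drop 2) (_ : take_poly 2 Phi = 0) ?add0r //.
  apply/polyP => i; rewrite coef_take_poly coef0; case: ifP => // i2.
  have iN : (i < N.+1)%N by rewrite (leq_trans i2) // (leq_trans N2).
  rewrite (coefPhi (Ordinal iN)); have := phi_low (Ordinal iN) i2.
  rewrite psiE => /eqP; rewrite mulf_eq0 expf_eq0 polyX_eq0 andbF => /eqP->.
  by rewrite horner0.
have Psi0 : Psi != 0.
  by apply: contra_neq Phi0 => P0; rewrite PhiE P0 mul0r.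
have sPsi : (size Psi <= N.-1)%N by rewrite size_drop_poly; lia.
have := @max_poly_roots K Psi [seq h.@[P] | P : {ffun 'I_n -> K} <- rem O A] Psi0.
rewrite size_map size_rem // => roots.
have : ((size A).-1 < N.-1)%N.
  apply: leq_trans sPsi; apply: roots.
    apply/allP => _ /mapP[P PA ->].
    have hP : h.@[P] != 0.
      apply: contraTneq (PA) => hP; rewrite mem_rem_uniq // inE.
      rewrite (_ : P = O) ?eqxx //; have PA' := mem_rem PA.
      by apply: csep => //; rewrite -!hE hP hO.
    have := rootPhi P (mem_rem PA); rewrite PhiE rootM => /orP[//|].
    by rewrite rootE hornerXn expf_eq0 (negPf hP) andbF.
  rewrite map_inj_in_uniq ?rem_uniq // => P P' /mem_rem PA /mem_rem PA' hh.
  by apply: csep => //; rewrite -!hE.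
by have : (0 < size A)%N by [case: (A) OA]; lia.
Qed.

Lemma unitmx_row (K : fieldType) n (v : 'rV[K]_n) (i0 : 'I_n) : v != 0 ->
  exists2 P : 'M[K]_n, P \in unitmx & row i0 P = v.
Proof.
move=> /rV0Pn[j0 vj0].
pose P0 : 'M[K]_n := \matrix_(i, j) if i == j0 then v 0 j else (i == j)%:R.
exists (xrow i0 j0 P0); last first.
  by apply/rowP => j; rewrite !mxE perm.tpermL eqxx.
rewrite xrowE unitmx_mul unitmx_perm /= unitmxE unitfE.
apply/det0P => -[u u0 uP]; move/eqP: u0; apply.
have uj j : u 0 j0 * v 0 j + u 0 j *+ (j != j0) = 0.
  have /rowP/(_ j) := uP; rewrite !mxE (bigD1 j0) //= mxE eqxx => E.
  rewrite -[RHS]E; congr (_ + _); have [->|jj0] := eqVneq j j0.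
    by rewrite big1 // => i ij0; rewrite mxE (negPf ij0) mulr0.
  rewrite (bigD1 j) //= mxE (negPf jj0) eqxx mulr1 big1 ?addr0 // => i.
  by move=> /andP[ij0 ij]; rewrite mxE (negPf ij0) (negPf ij) mulr0.
have uj0 : u 0 j0 = 0.
  have /eqP := uj j0; rewrite eqxx mulr0n addr0 mulf_eq0 (negPf vj0) orbF.
  by move/eqP.
apply/rowP => j; rewrite mxE; have := uj j; rewrite uj0 mul0r add0r.
by have [->|] := eqVneq j j0; [rewrite uj0|].
Qed.

Section Substitution.

Variables (K : fieldType) (n : nat) (l : 'I_n -> {mpoly K[n]}).

Definition subst (p : {mpoly K[n]}) : {mpoly K[n]} := mmap (@mpolyC n K) l p.

Lemma subst_rmorph (S : comNzRingType) (h : {rmorphism {mpoly K[n]} -> S}) p :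
  h (subst p) = mmap (h \o @mpolyC n K) (h \o l) p.
Proof.
rewrite /subst /mmap rmorph_sum; apply: eq_bigr => m _.
rewrite rmorphM /mmap1 rmorph_prod /=; congr (_ * _).
by apply: eq_bigr => i _; rewrite rmorphXn.
Qed.

Lemma meval_subst Q p : (subst p).@[Q] = p.@[fun i => (l i).@[Q]].
Proof.
rewrite subst_rmorph [RHS]/meval /mmap; apply: eq_bigr => m _ /=.
by rewrite mevalC.
Qed.

Lemma msize_subst p : (forall i, msize (l i) <= 2)%N -> (msize (subst p) <= msize p)%N.
Proof.
move=> l2; rewrite /subst /mmap; apply: leq_trans (msize_sum _ _ _) _.
apply/bigmax_leqP_seq => m mp _; apply: leq_trans (msize_mdeg_lt mp).
rewrite mul_mpolyC; apply: leq_trans (msizeZ_le _ _) _; rewrite /mmap1 mdegE.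
elim/big_ind2: _ => [|p1 d1 p2 d2 p1d p2d|i _]; first by rewrite msize1.
  exact: msizeM_leq.
exact: msizeX_leq.
Qed.

End Substitution.

(** An affine change of coordinates moves Q to the origin and v to the vector of
an axis i0 with 1 < k i0. There is no such axis when all the f_i are affine,
but then the f_i vanish on the whole line through Q with direction v, and the
zero set is infinite. *)
Lemma double_zero_bound (K : closedFieldType) n (k : 'I_n -> nat)
    (f : 'I_n -> {mpoly K[n]}) (A : seq {ffun 'I_n -> K}) (Q v : 'I_n -> K) :
  has_large_fibre K -> (forall i, 0 < k i)%N ->
  (forall i, msize (f i) <= (k i).+1)%N ->
  (exists j, v j != 0) -> (forall i, 'X^2 %| along Q v (f i)) ->
  is_zero_set f A -> uniq A -> (size A < \prod_i k i)%N.
Proof.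
move=> largeK k0 fk [j0 vj0] ftan fA uA.
have [[i0 k2]|k1] := EM (exists i, 1 < k i)%N; last first.
  have f0 i : along Q v (f i) = 0.
    apply/eqP; apply: contraLR (ftan i) => fi0; apply/negP => /dvdp_leq -/(_ fi0).
    rewrite size_polyXn leqNgt ltnS; apply/negP/negPn.
    apply: leq_trans (size_along _ _ _) _; apply: leq_trans (fk i) _.
    by rewrite ltnS leqNgt; apply/negP => ki; apply: k1; exists i.
  have [_ /(_ (size A).+1)[s [us ss _]]] := largeK (fun _ => 0%N).
  pose pt a : {ffun 'I_n -> K} := [ffun j => Q j + v j * a].
  have : (size (map pt s) <= size A)%N.
    apply: uniq_leq_size => [|_ /mapP[a _ ->]].
      rewrite map_inj_uniq // => a b /ffunP/(_ j0); rewrite !ffunE => /addrI.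
      exact: mulfI.
    apply/fA => i; rewrite (@meval_eq _ _ _ (fun j => Q j + v j * a)).
      by rewrite -horner_along f0 horner0.
    by move=> j; rewrite ffunE.
  by rewrite size_map ss ltnn.
have v0 : \row_j v j != 0 by apply/rV0Pn; exists j0; rewrite mxE.
have [P Pu Pv] := unitmx_row i0 v0.
pose l j : {mpoly K[n]} := (Q j)%:MP + \sum_i P i j *: 'X_i.
pose sg (y : {ffun 'I_n -> K}) : {ffun 'I_n -> K} :=
  [ffun j => Q j + ((\row_i y i) *m P) 0 j].
pose tau (x : {ffun 'I_n -> K}) : {ffun 'I_n -> K} :=
  [ffun j => ((\row_i (x i - Q i)) *m invmx P) 0 j].
have sgK : cancel sg tau.
  move=> y; apply/ffunP => j; rewrite ffunE (_ : \row_i _ = (\row_i y i) *m P).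
    by rewrite mulmxK // mxE.
  by apply/rowP => i; rewrite mxE ffunE addrC addKr.
have tauK : cancel tau sg.
  move=> x; apply/ffunP => j; rewrite ffunE.
  rewrite (_ : \row_i _ = (\row_i (x i - Q i)) *m invmx P).
    by rewrite mulmxKV // mxE addrC subrK.
  by apply/rowP => i; rewrite mxE ffunE.
have lsg (y : {ffun 'I_n -> K}) j : (l j).@[y] = sg y j.
  rewrite /l mevalD mevalC ffunE; congr (_ + _); rewrite rmorph_sum mxE /=.
  by apply: eq_bigr => i _; rewrite mevalZ mevalXU mxE mulrC.
have l2 j : (msize (l j) <= 2)%N.
  apply: leq_trans (msizeD_le _ _) _; rewrite geq_max msizeC; apply/andP; split.
    by case: (_ != _).
  apply: leq_trans (msize_sum _ _ _) _; apply/bigmax_leqP => i _.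
  by apply: leq_trans (msizeZ_le _ _) _; rewrite msizeX mdeg1.
rewrite -(size_map tau).
apply: (@double_zero_bound_normal K n k (fun i => subst l (f i)) _ i0) => //.
- by move=> i; apply: leq_trans (msize_subst _ l2) (fk i).
- move=> i; rewrite subst_rmorph.
  rewrite (_ : mmap _ _ _ = along Q v (f i)) ?ftan // /along /mmap.
  apply: eq_bigr => m _ /=; congr (_ * _); first exact: alongC.
  apply: eq_bigr => j _; congr (_ ^+ _).
  rewrite /= /l rmorphD /= alongC; congr (_ + _).
  rewrite rmorph_sum (bigD1 i0) //= [X in _ + X]big1 ?addr0 => [|i' ii0];
    rewrite -mul_mpolyC rmorphM /= alongC alongX polyC0 add0r.
    by rewrite eqxx scale1r mul_polyC; congr (_ *: _);
       have /rowP/(_ j) := Pv; rewrite !mxE.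
  by rewrite (negPf ii0) scale0r mulr0.
- move=> y; rewrite -(mem_map (can_inj sgK)) -map_comp (eq_map (g := id));
    last exact: tauK.
  rewrite map_id fA; have E i : (subst l (f i)).@[y] = (f i).@[sg y].
    by rewrite meval_subst; apply: meval_eq => j; rewrite lsg.
  by split=> h i; have := h i; rewrite E.
- by rewrite map_inj_uniq //; apply: can_inj tauK.
Qed.

(** * The Bezoutian and the Cayley-Bacharach property *)

Section Bezoutian.

Variables (K : fieldType) (n : nat).
Implicit Types (F G : ('I_n -> K) -> {mpoly K[n]}).

(** A polynomial in a pair (x, y) of points, of total degree at most d, kept as
a function of x with values in polynomials in y; each term p(x) q(y) carries
its own splitting of the degree. *)
Definition bidegree_le d F := exists s : seq ({mpoly K[n]} * {mpoly K[n]}),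
  (forall x, x \in s -> exists a b,
     [/\ (a + b <= d)%N, (msize x.1 <= a.+1)%N & (msize x.2 <= b.+1)%N]) /\
  forall Q, F Q = \sum_(x <- s) x.1.@[Q] *: x.2.

Lemma bidegree_le0 d : bidegree_le d (fun _ => 0).
Proof. by exists [::]; split=> // Q; rewrite big_nil. Qed.

Lemma bidegree_le_sep d a b p q : (a + b <= d)%N -> (msize p <= a.+1)%N ->
  (msize q <= b.+1)%N -> bidegree_le d (fun Q => p.@[Q] *: q).
Proof.
move=> ab pa qb; exists [:: (p, q)]; split=> [x|Q]; last by rewrite big_seq1.
by rewrite inE => /eqP->; exists a, b.
Qed.

Lemma bidegree_leD d F G : bidegree_le d F -> bidegree_le d G ->
  bidegree_le d (fun Q => F Q + G Q).
Proof.
move=> [s [sd sF]] [t [td tG]]; exists (s ++ t); split=> [x|Q].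
  by rewrite mem_cat => /orP[/sd|/td].
by rewrite big_cat sF tG.
Qed.

Lemma bidegree_leM d e F G : bidegree_le d F -> bidegree_le e G ->
  bidegree_le (d + e) (fun Q => F Q * G Q).
Proof.
move=> [s [sd sF]] [t [td tG]].
exists [seq (x.1 * y.1, x.2 * y.2) | x <- s, y <- t]; split=> [z|Q].
  move=> /allpairsP[[x y] /= [/sd[a [b [ab xa xb]]] /td[a' [b' [ab' ya yb]]] ->]].
  exists (a + a')%N, (b + b')%N; split=> /=.
  - by rewrite addnACA; apply: leq_add.
  - exact: msizeM_leq.
  - exact: msizeM_leq.
rewrite sF tG big_allpairs_dep mulr_suml; apply: eq_bigr => x _.
rewrite mulr_sumr; apply: eq_bigr => y _ /=.
by rewrite mevalM -scalerAl -scalerAr scalerA.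
Qed.

Lemma bidegree_le_cst d c : bidegree_le d (fun _ => c%:MP).
Proof.
have [s [sd sF]] := @bidegree_le_sep d 0 0 c%:MP 1 isT
  (ltac:(by rewrite msizeC; case: (_ != _))) (ltac:(by rewrite msize1)).
exists s; split=> // Q; rewrite -sF mevalC.
by rewrite -mul_mpolyC mulr1.
Qed.

Lemma bidegree_le_ext d F G : (forall Q, F Q = G Q) -> bidegree_le d F ->
  bidegree_le d G.
Proof. by move=> FG [s [sd sF]]; exists s; split=> // Q; rewrite -FG. Qed.

Lemma bidegree_le_sum d (I : Type) (r : seq I) (F : I -> ('I_n -> K) -> {mpoly K[n]}) :
  (forall i, bidegree_le d (F i)) -> bidegree_le d (fun Q => \sum_(i <- r) F i Q).
Proof.
move=> Fd; elim: r => [|i r IHr].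
  by apply: bidegree_le_ext (bidegree_le0 d) => Q; rewrite big_nil.
by apply: bidegree_le_ext (bidegree_leD (Fd i) IHr) => Q; rewrite big_cons.
Qed.

Lemma bidegree_le_prod (I : Type) (r : seq I) (d : I -> nat)
    (F : I -> ('I_n -> K) -> {mpoly K[n]}) :
  (forall i, bidegree_le (d i) (F i)) ->
  bidegree_le (\sum_(i <- r) d i) (fun Q => \prod_(i <- r) F i Q).
Proof.
move=> Fd; elim: r => [|i r IHr].
  apply: bidegree_le_ext (bidegree_le_cst _ 1) => Q.
  by rewrite big_nil mpolyC1.
rewrite big_cons; apply: bidegree_le_ext (bidegree_leM (Fd i) IHr) => Q.
by rewrite big_cons.
Qed.

(** For X^m = X_i X^m', the product rule
X_i X^m' - Q_i Q^m' = X_i (X^m' - Q^m') + (X_i - Q_i) Q^m'. *)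
Lemma divided_differences_mnm d m : (mdeg m <= d.+1)%N ->
  exists D : 'I_n -> ('I_n -> K) -> {mpoly K[n]},
    (forall j, bidegree_le d (D j)) /\ forall Q,
    'X_[m] - ('X_[m] : {mpoly K[n]}).@[Q]%:MP = \sum_j ('X_j - (Q j)%:MP) * D j Q.
Proof.
have mnm0Pn (m1 : 'X_{1..n}) : m1 = 0%MM \/ exists i, m1 i != 0%N.
  have [im|m0] := EM (exists i, m1 i != 0%N); [by right|left].
  apply/mnmP => i; rewrite mnm0E; apply/eqP/negPn/negP => im.
  by apply: m0; exists i.
have const e : exists D : 'I_n -> ('I_n -> K) -> {mpoly K[n]},
    (forall j, bidegree_le e (D j)) /\ forall Q,
    'X_[0] - ('X_[0] : {mpoly K[n]}).@[Q]%:MP = \sum_j ('X_j - (Q j)%:MP) * D j Q.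
  exists (fun _ _ => 0); split=> [j|Q]; first exact: bidegree_le0.
  by rewrite mpolyX0 meval1 subrr big1 // => j _; rewrite mulr0.
elim: d m => [|d IHd] m md; have [->|[i im]] := mnm0Pn m; rewrite ?const //.
all: have mE : m = (U_(i) + (m - U_(i)))%MM by rewrite addmC submK // lep1mP.
all: have md' : (mdeg m = (mdeg (m - U_(i))).+1)%N by rewrite {1}mE mdegD mdeg1.
- have {mE}-> : m = U_(i)%MM.
    rewrite mE (_ : (m - U_(i))%MM = 0%MM) ?addm0 //; apply/eqP.
    by rewrite -mdeg_eq0 -leqn0 -ltnS -md'.
  exists (fun j _ => (j == i)%:R%:MP); split=> [j|Q]; first exact: bidegree_le_cst.
  rewrite mevalXU (bigD1 i) //= eqxx mpolyC1 mulr1 big1 ?addr0 // => j /negPf->.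
  by rewrite mpolyC0 mulr0.
- have [|D [Dd DE]] := IHd (m - U_(i))%MM; first by rewrite -ltnS -md'.
  set m' := (m - U_(i))%MM in mE md' D Dd DE.
  exists (fun j Q => 'X_i * D j Q + (j == i)%:R *: ('X_[m'] : {mpoly K[n]}).@[Q]%:MP).
  split=> [j|Q].
    apply: bidegree_leD.
      have Xd : bidegree_le 1 (fun _ => 'X_i).
        apply: bidegree_le_ext (@bidegree_le_sep 1 0 1 1 'X_i isT _ _) => [Q||].
        - by rewrite meval1 scale1r.
        - by rewrite msize1.
        - by rewrite msizeX mdeg1.
      by rewrite -add1n; apply: bidegree_leM.
    apply: bidegree_le_ext
      (@bidegree_le_sep d.+1 d.+1 0 'X_[m'] (j == i)%:R%:MP _ _ _) => [Q|||].
    + by rewrite -!mul_mpolyC -!mpolyCM mulrC.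
    + by rewrite addn0.
    + by rewrite msizeX -md'; apply: leq_trans md _.
    + by rewrite msizeC; case: (_ != _).
  rewrite [in LHS]mE mpolyXD mevalM mevalXU mpolyCM.
  under eq_bigr do rewrite mulrDr mulrCA.
  rewrite big_split /= -mulr_sumr -DE (bigD1 i) //= eqxx scale1r.
  rewrite big1 => [|j /negPf->]; last by rewrite scale0r mulr0.
  by rewrite addr0; ring.
Qed.

Lemma divided_differences d (p : {mpoly K[n]}) : (msize p <= d.+2)%N ->
  exists D : 'I_n -> ('I_n -> K) -> {mpoly K[n]},
    (forall j, bidegree_le d (D j)) /\
    forall Q, p - (p.@[Q])%:MP = \sum_j ('X_j - (Q j)%:MP) * D j Q.
Proof.
move=> pd.
have /choice [D DP] : forall m, exists D : 'I_n -> ('I_n -> K) -> {mpoly K[n]},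
  (mdeg m <= d.+1)%N -> (forall j, bidegree_le d (D j)) /\ forall Q,
  'X_[m] - ('X_[m] : {mpoly K[n]}).@[Q]%:MP = \sum_j ('X_j - (Q j)%:MP) * D j Q.
  move=> m; have [/divided_differences_mnm[D DP]|_] := leqP (mdeg m) d.+1.
    by exists D.
  by exists (fun _ _ => 0).
exists (fun j Q => \sum_(m : 'X_{1..n < d.+2}) p@_m *: D m j Q); split=> [j|Q].
  apply: bidegree_le_sum => m.
  apply: bidegree_le_ext (bidegree_leM (bidegree_le_cst 0 (p@_m)) ((DP m _).1 j)) => [Q|].
    by rewrite mul_mpolyC.
  by rewrite -ltnS bmdeg.
under eq_bigr do rewrite mulr_sumr.
rewrite exchange_big /= [in LHS](mpolywE pd) (raddf_sum (meval Q)).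
rewrite (raddf_sum (@mpolyC n K)) /=.
rewrite -sumrB; apply: eq_bigr => m _.
rewrite mevalZ mpolyCM mul_mpolyC -scalerBr (DP m _).2; last by rewrite -ltnS bmdeg.
by rewrite scaler_sumr; apply: eq_bigr => j _; rewrite scalerAr.
Qed.

Lemma bezoutian (k : 'I_n -> nat) (f : 'I_n -> {mpoly K[n]}) :
  (forall i, 0 < k i)%N -> (forall i, msize (f i) <= (k i).+1)%N ->
  exists D : ('I_n -> K) -> 'M[{mpoly K[n]}]_n,
    bidegree_le (\sum_i (k i).-1) (fun Q => \det (D Q)) /\
    forall Q i, f i - (f i).@[Q]%:MP = \sum_j D Q i j * ('X_j - (Q j)%:MP).
Proof.
move=> k0 fk.
have /choice [D DP] : forall i, exists D : 'I_n -> ('I_n -> K) -> {mpoly K[n]},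
    (forall j, bidegree_le (k i).-1 (D j)) /\
    forall Q, f i - ((f i).@[Q])%:MP = \sum_j ('X_j - (Q j)%:MP) * D j Q.
  by move=> i; apply: divided_differences; rewrite prednK.
exists (fun Q => \matrix_(i, j) D i j Q); split=> [|Q i]; last first.
  rewrite (DP i).2; apply: eq_bigr => j _; by rewrite mxE mulrC.
rewrite /determinant; apply: bidegree_le_sum => s.
rewrite -[X in bidegree_le X _]add0n; apply: bidegree_leM.
  apply: bidegree_le_ext (bidegree_le_cst 0 ((-1) ^+ perm.odd_perm s)) => Q.
  by rewrite rmorphXn rmorphN /= mpolyC1.
apply: bidegree_le_ext (bidegree_le_prod _ _) => [Q|i].
  by under [RHS]eq_bigr do rewrite mxE.
exact: (DP i).1.
Qed.

End Bezoutian.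

Lemma polyspace_sum (K : fieldType) n (m : int) (I : Type) (r : seq I) (P : pred I)
    (F : I -> {mpoly K[n]}) :
  (forall i, P i -> polyspace m (F i)) -> polyspace m (\sum_(i <- r | P i) F i).
Proof.
case: m => d Fd /=; last first.
  by rewrite big1 // => i /Fd /eqP.
apply: (big_ind (fun p : {mpoly K[n]} => msize p <= d.+1)%N) => [|p q pd qd|//].
  by rewrite /= msize0.
by apply: leq_trans (msizeD_le _ _) _; rewrite geq_max pd.
Qed.

Lemma polyspaceZ (K : fieldType) n (m : int) c (p : {mpoly K[n]}) :
  polyspace m p -> polyspace m (c *: p).
Proof.
case: m => d /=; first exact: leq_trans (msizeZ_le _ _).
by move=> /eqP->; rewrite scaler0.
Qed.

Lemma polyspaceW (K : fieldType) n a (m : int) (p : {mpoly K[n]}) :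
  (a%:Z <= m) -> (msize p <= a.+1)%N -> polyspace m p.
Proof. by case: m => d //= ad /leq_trans; apply. Qed.

(** A vector in the kernel of D(Q, Q), the Jacobian matrix of f at Q, is a
tangent vector common to all the f_i. *)
Lemma bezoutian_diagonal_neq0 (K : closedFieldType) n (k : 'I_n -> nat)
    (f : 'I_n -> {mpoly K[n]}) (A : seq {ffun 'I_n -> K}) (Q : 'I_n -> K)
    (D : 'M[{mpoly K[n]}]_n) :
  has_large_fibre K -> (forall i, 0 < k i)%N ->
  (forall i, msize (f i) <= (k i).+1)%N ->
  is_zero_set f A -> uniq A -> size A = (\prod_i k i)%N ->
  (forall i, f i = \sum_j D i j * ('X_j - (Q j)%:MP)) -> (\det D).@[Q] != 0.
Proof.
move=> largeK k0 fk fA uA sA fD; rewrite -det_map_mx /= -det_tr.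
apply/negP => /det0P[v v0 vD].
suff : (size A < \prod_i k i)%N by rewrite sA ltnn.
apply: (@double_zero_bound K n k f A Q (v 0)) => //; first exact/rV0Pn.
move=> i.
have -> : along Q (v 0) (f i) = \sum_j along Q (v 0) (D i j) * (v 0 j *: 'X).
  rewrite [in LHS]fD rmorph_sum; apply: eq_bigr => j _.
  by rewrite rmorphM rmorphB /= alongC alongX addrC addKr.
rewrite (_ : \sum_j _ = (\sum_j v 0 j *: along Q (v 0) (D i j)) * 'X); last first.
  rewrite mulr_suml; apply: eq_bigr => j _.
  by rewrite -scalerAr -scalerAl.
rewrite expr2 dvdp_mul2r ?polyX_eq0 // -['X]subr0 -polyC0 dvdp_XsubCl rootE.
rewrite horner_sum; apply/eqP; have /rowP/(_ i) := vD; rewrite !mxE => E.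
rewrite -[RHS]E; apply: eq_bigr => j _.
by rewrite hornerZ along0 !mxE.
Qed.

(** A relation c of degree M - m - 1 between the points of A is, up to the
nonzero factors det D(Q, Q), the restriction to A of a polynomial of degree at
most m; vanishing on the unisolvent set B forces it to be zero. *)
Theorem cayley_bacharach (K : closedFieldType) n (k : 'I_n -> nat)
    (f : 'I_n -> {mpoly K[n]}) (A : seq {ffun 'I_n -> K})
    (B : {pred {ffun 'I_n -> K}}) (m : int) (c : {ffun 'I_n -> K} -> K) :
  has_large_fibre K -> (forall i, 0 < k i)%N ->
  (forall i, msize (f i) <= (k i).+1)%N ->
  is_zero_set f A -> uniq A -> size A = (\prod_i k i)%N ->
  (forall g : {mpoly K[n]}, polyspace m g ->
     {in B, forall Q : {ffun 'I_n -> K}, g.@[Q] = 0} -> g = 0) ->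
  {subset B <= A} -> {in B, forall Q, c Q = 0} ->
  (forall p : {mpoly K[n]}, polyspace ((\sum_i (k i).-1)%N%:Z - m - 1) p ->
    \sum_(Q <- A) c Q * p.@[Q] = 0) ->
  {in A, forall Q, c Q = 0}.
Proof.
move=> largeK k0 fk fA uA sA Bunisolvent BA cB cP.
have [D [[s [sd sE]] DE]] := bezoutian k0 fk.
have fA0 Q i : Q \in A -> (f i).@[Q] = 0 by move=> /fA.
have diag Q : Q \in A -> (\det (D Q)).@[Q] != 0.
  move=> QA; apply: (bezoutian_diagonal_neq0 largeK k0 fk fA uA sA) => i.
  by rewrite -DE fA0 // mpolyC0 subr0.
have offdiag Q Q' : Q \in A -> Q' \in A -> Q' != Q -> (\det (D Q)).@[Q'] = 0.
  move=> QA Q'A Q'Q; rewrite -det_map_mx /= -det_tr; apply/eqP/det0P.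
  exists (\row_j (Q' j - Q j)).
    apply/rV0Pn; apply: contrapT => /forallNP Q'Q0; move/negP: Q'Q; apply.
    apply/eqP/ffunP => j; apply/eqP; rewrite -subr_eq0; apply/negPn/negP => h.
    by apply: (Q'Q0 j); rewrite mxE.
  apply/rowP => i; rewrite !mxE.
  have := congr1 (meval Q') (DE Q i); rewrite fA0 // mpolyC0 subr0 fA0 // => E.
  rewrite [RHS]E rmorph_sum; apply: eq_bigr => j _.
  by rewrite !mxE /= mevalM mevalB mevalXU mevalC mulrC.
pose g := \sum_(Q <- A) c Q *: \det (D Q).
have gA Q : Q \in A -> g.@[Q] = c Q * (\det (D Q)).@[Q].
  move=> QA; rewrite /g (raddf_sum (meval Q)) (bigD1_seq Q QA uA) /=.
  rewrite [X in X + _]mevalZ.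
  rewrite big_seq_cond.
  rewrite big1 ?addr0 // => Q' /andP[Q'A Q'Q].
  by rewrite mevalZ offdiag ?mulr0 // eq_sym.
have gm : polyspace m g.
  rewrite (_ : g = \sum_(x <- s) (\sum_(Q <- A) c Q * x.1.@[Q]) *: x.2).
    rewrite big_seq; apply: polyspace_sum => x /sd[a [b [ab xa xb]]].
    have [am|ma] := lerP a%:Z ((\sum_i (k i).-1)%N%:Z - m - 1).
      rewrite cP ?scale0r; last exact: polyspaceW am xa.
      by case: (m) => //=; rewrite msize0.
    by apply: polyspaceZ; apply: polyspaceW xb; lia.
  under [RHS]eq_bigr do rewrite scaler_suml.
  rewrite exchange_big; apply: eq_bigr => Q _ /=.
  rewrite sE scaler_sumr; apply: eq_bigr => x _.
  by rewrite scalerA.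
have g0 : g = 0.
  by apply: Bunisolvent => // Q QB; rewrite gA ?BA // cB // mul0r.
move=> Q QA; have /eqP := gA Q QA; rewrite g0 meval0 eq_sym mulf_eq0.
by rewrite (negPf (diag Q QA)) orbF => /eqP.
Qed.

(** * Interpolation from the absence of linear relations *)

Lemma interpolation_of_no_relation (K : fieldType) n (d : int)
    (C : seq {ffun 'I_n -> K}) : uniq C ->
  (forall c : {ffun 'I_n -> K} -> K,
     (forall p : {mpoly K[n]}, polyspace d p -> \sum_(Q <- C) c Q * p.@[Q] = 0) ->
     {in C, forall Q, c Q = 0}) ->
  forall q : {ffun 'I_n -> K} -> K, exists p : {mpoly K[n]},
    polyspace d p /\ {in C, forall Q : {ffun 'I_n -> K}, p.@[Q] = q Q}.
Proof.
move=> uC; case: d => e /= norel q; last first.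
  exists 0; split=> // Q QC.
  suff /(_ Q QC)/eqP : {in C, forall _, 1 = 0 :> K} by rewrite oner_eq0.
  apply: (norel (fun _ => 1)) => p /eqP->.
  by rewrite big1 // => Q' _; rewrite meval0 mulr0.
pose mv (a : 'I_#|{: 'X_{1..n < e.+1}}|) : 'X_{1..n < e.+1} := enum_val a.
pose x0 : {ffun 'I_n -> K} := [ffun _ => 0].
pose pt (b : 'I_(size C)) := nth x0 C b.
pose V : 'M[K]_(_, _) := \matrix_(b, a) ('X_[mv a] : {mpoly K[n]}).@[pt b].
have Vfree : row_free V.
  apply: inj_row_free => u uV; apply/rowP => b; rewrite mxE.
  pose c Q := \sum_b u 0 b *+ (pt b == Q).
  have cpt b' : c (pt b') = u 0 b'.
    rewrite /c (bigD1 b') //= eqxx big1 ?addr0 // => b1 b1b.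
    by rewrite nth_uniq // (inj_eq val_inj) (negPf b1b).
  rewrite -cpt; apply: (norel _ _ _ (mem_nth _ (ltn_ord b))) => p pe.
  rewrite (big_nth x0) big_mkord.
  rewrite [p in LHS](mpolywE pe); under eq_bigr do rewrite rmorph_sum mulr_sumr.
  rewrite exchange_big big1 // => m _ /=.
  have /rowP/(_ (enum_rank m)) := uV; rewrite !mxE => E.
  rewrite -[RHS](mulr0 p@_m) -[in RHS]E mulr_sumr; apply: eq_bigr => b1 _.
  by rewrite mxE /mv enum_rankK mevalZ -/(pt b1) cpt mulrCA.
have /row_freeP[W VW] := Vfree.
pose w := W *m \col_b q (pt b).
exists (\sum_a w a 0 *: 'X_[mv a]); split.
  apply: leq_trans (msize_sum _ _ _) _; apply/bigmax_leqP => a _.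
  by apply: leq_trans (msizeZ_le _ _) _; rewrite msizeX; apply: bmdeg.
move=> Q QC; have QE : nth x0 C (index Q C) = Q by apply: nth_index.
have Qlt : (index Q C < size C)%N by rewrite index_mem.
have : (V *m w) (Ordinal Qlt) 0 = q Q.
  by rewrite /w mulmxA VW mul1mx mxE /pt /= QE.
rewrite mxE => <-; rewrite rmorph_sum; apply: eq_bigr => a _ /=.
by rewrite mevalZ [V _ _]mxE mulrC /pt /= QE.
Qed.

(** * The Hilbert function of a complete intersection *)

(** Convolution with the indicator of [0, k), that is, multiplication of the
generating series by 1 + z + ... + z^(k-1). *)
Definition box_sum (k : nat) (u : int -> int) (d : int) : int :=
  \sum_(i < k) u (d - i%:Z).

Lemma space_dimS n d : space_dim n.+1 d - space_dim n.+1 (d - 1) = space_dim n d.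
Proof.
case: d => [[|d]|d] //; first by rewrite /= !binn.
rewrite (_ : d.+1%:Z - 1 = d%:Z); last by lia.
by rewrite /= addSn !addnS binS addSn; lia.
Qed.

Lemma backward_diff_space_dim n k :
  backward_diff (space_dim n.+1) k = box_sum k (space_dim n).
Proof.
apply/funext => d; rewrite /backward_diff /box_sum.
elim: k => [|k IHk]; first by rewrite big_ord0 subr0 subrr.
rewrite big_ord_recr /= -IHk -(space_dimS n (d - k%:Z)).
by rewrite (_ : d - k%:Z - 1 = d - k.+1%:Z); [ring|lia].
Qed.

Lemma foldl_box_sum k u ks :
  foldl backward_diff (box_sum k u) ks = box_sum k (foldl backward_diff u ks).
Proof.
elim: ks u => //= k' ks IHks u; rewrite -IHks; congr foldl.
apply/funext => d; rewrite /backward_diff /box_sum -sumrB.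
by apply: eq_bigr => i _; congr (_ - u _); lia.
Qed.

Definition unit_step (d : int) : int := if 0 <= d then 1 else 0.

(** Each difference turns the space dimension in n + 1 variables into a box sum
of the space dimension in n variables. After n differences the unit step is
left, and the value at d counts the monomials with exponents less than the
entries of ks and of degree at most d. *)
Lemma space_dim_diff_box_sum ks :
  space_dim_diff (size ks) ks = foldr box_sum unit_step ks.
Proof.
rewrite /space_dim_diff; elim: ks => [|k ks IHks] /=.
  by apply/funext => -[d|d] //=; rewrite bin0.
by rewrite backward_diff_space_dim foldl_box_sum IHks.
Qed.

(** Reversing the exponents, i to k - 1 - i, exchanges the monomials in the box of
degree at most M - 1 - d with those of degree more than d, where M is the sum
of the predecessors of the entries of ks. *)
Lemma space_dim_diff_symmetry ks d : all (fun k => 0 < k)%N ks ->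
  space_dim_diff (size ks) ks d +
  space_dim_diff (size ks) ks ((\sum_(k <- ks) k.-1)%N%:Z - 1 - d) =
  (\prod_(k <- ks) k)%N%:Z.
Proof.
rewrite !space_dim_diff_box_sum; elim: ks d => [|k ks IHks] d /=.
  move=> _; rewrite !big_nil /unit_step.
  by case: (lerP 0 d) => h; case: lerP => h' //; lia.
move=> /andP[k0 ks0]; rewrite /box_sum !big_cons.
rewrite [X in _ + X](reindex_inj rev_ord_inj) -big_split /=.
under eq_bigr => i _.
  rewrite (_ : _ - _ - d - _ = (\sum_(j <- ks) j.-1)%N%:Z - 1 - (d - i%:Z)).
    rewrite IHks //; over.
  by have := ltn_ord i; lia.
by rewrite sumr_const card_ord -mulr_natl natz PoszM.
Qed.

Lemma space_dim_diff_small n ks (m : int) : all (fun k => m < k%:Z) ks ->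
  space_dim_diff n ks m = space_dim n m.
Proof.
rewrite /space_dim_diff.
have : forall d, d < 0 -> space_dim n d = 0 by case.
elim: ks (space_dim n) => //= k ks IHks u u0 /andP[mk mks].
rewrite IHks //; first by rewrite /backward_diff [u (m - _)]u0 ?subr0 //; lia.
by move=> d d0; rewrite /backward_diff !u0 //; lia.
Qed.

(** * Interpolation along a curve *)

Lemma leq_bigmin_seq (I : eqType) (s : seq I) (x : nat) (k : I -> nat) i :
  i \in s -> (\big[minn/x]_(j <- s) k j <= k i)%N.
Proof.
elim: s => // j s IHs; rewrite inE big_cons => /predU1P[->|/IHs]; first exact: geq_minl.
exact/leq_trans/geq_minr.
Qed.

Lemma space_dim_diff_rcons n ks k d : space_dim_diff n (rcons ks k) d =
  space_dim_diff n ks d - space_dim_diff n ks (d - k%:Z).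
Proof. by rewrite /space_dim_diff foldl_rcons. Qed.

(** Extending a relation by zero on B turns it into a relation on A. *)
Lemma complement_interpolation (K : closedFieldType) n (k : 'I_n -> nat)
    (f : 'I_n -> {mpoly K[n]}) (A B : {fset {ffun 'I_n -> K}}) (m : int) :
  has_large_fibre K -> (forall i, 0 < k i)%N ->
  (forall i, msize (f i) <= (k i).+1)%N ->
  is_zero_set f A -> #|` A| = (\prod_i k i)%N -> fsubset B A -> PPSN m B ->
  forall q : {ffun 'I_n -> K} -> K, exists p : {mpoly K[n]},
    polyspace ((\sum_i (k i).-1)%N%:Z - m - 1) p /\
    {in fsetD A B, forall Q : {ffun 'I_n -> K}, p.@[Q] = q Q}.
Proof.
move=> largeK k0 fk fA cA BA [cB Bint].
apply: interpolation_of_no_relation => [|c cP Q QC]; first exact: fset_uniq.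
pose C := fsetD A B; pose c' Q := if Q \in C then c Q else 0.
have CA : {subset C <= A} by move=> P; rewrite inE => /andP[].
have -> : c Q = c' Q by rewrite /c' QC.
apply: (cayley_bacharach (A := A) (B := mem B) (m := m) largeK k0 fk fA (fset_uniq _) cA).
- move=> g gm gB; have [g0 [_ g0u]] := Bint (fun _ => 0).
  rewrite -(g0u g) ?(g0u 0) //; split=> // [|P _]; last exact: meval0.
  by case: (m) => //= e; rewrite msize0.
- exact/fsubsetP.
- by move=> P PB; rewrite /c' /C inE PB.
- move=> p pd; rewrite -[RHS](cP p pd).
  rewrite (bigID (fun P => P \in C)) /= [X in _ + X]big1 => [|P /negPf PC]; last first.
    by rewrite /c' PC mul0r.
  rewrite addr0 -big_filter (perm_big C); last first.
    apply: uniq_perm => [||P]; rewrite ?filter_uniq ?fset_uniq // mem_filter.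
    by case: (boolP (P \in C)) => //= /CA.
  rewrite !big_seq; apply: eq_bigr => P PC.
  by rewrite /c' (PC : P \in C).
- exact: CA.
Qed.

Unset Implicit Arguments.

Local Open Scope fset_scope.

Theorem theorem5p5 (R : realType) (n : nat) (k : 'I_n -> nat) (m : int)
    (f : 'I_n -> {mpoly (complex R)[n]}) (t : 'I_n)
    (A B At : {fset {ffun 'I_n -> complex R}}) :
  let L : nat := \big[minn/k t]_(i < n) k i in
  let M : int := (\sum_(i < n) k i)%N%:Z - n%:Z in
  let S1 : seq {mpoly (complex R)[n]} :=
    [seq f i | i <- enum 'I_n & i != t] in
  (forall i, (0 < k i)%N) ->
  m <= L%:Z - 1 ->
  (forall i, msize (f i) = (k i).+1) ->
  (forall i, no_multiple_factors (f i)) ->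
  (forall Q, (Q \in A) = common_zeros [seq f i | i <- enum 'I_n] Q) ->
  #|` A| = (\prod_(i < n) k i)%N ->
  B `<=` A ->
  PPSN m B ->
  PPSN_along S1 (M - m - (k t)%:Z - 1) At ->
  At `&` A = fset0 ->
  PPSN_along S1 (M - m - 1) (At `|` (A `\` B)).
Proof.
move=> L M S1 k0 mL fk _ fA cA BA BP [cAt AtS1 Atint] AtA.
have largeK := @complex_has_large_fibre R.
have zA : is_zero_set f A.
  move=> Q; change (Q \in A <-> forall i, (f i).@[Q] = 0); rewrite fA; split.
    by move=> /allP h i; apply/eqP; apply: h; rewrite map_f ?mem_enum.
  by move=> h; apply/allP => _ /mapP[i _ ->]; rewrite h.
have ME : M = (\sum_i (k i).-1)%N%:Z.
  rewrite /M; have -> : (\sum_i k i = \sum_i (k i).-1 + n)%N.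
    have nE : (\sum_(i < n) 1 = n)%N by rewrite sum1_card card_ord.
    rewrite -[X in _ = (_ + X)%N]nE -big_split /=.
    by apply: eq_bigr => i _; rewrite addn1 prednK.
  by lia.
have S1A Q : Q \in A -> common_zeros S1 Q.
  move=> /zA h; apply/allP => _ /mapP[i _ ->]; by rewrite h.
split.
- have dis : [disjoint At & A `\` B]%fset.
    rewrite -fsetI_eq0 -fsubset0; apply/fsubsetP => Q; rewrite !inE => /and3P[QAt _ QA].
    by have : Q \in At `&` A; [rewrite inE QAt | rewrite AtA].
  rewrite cardfsU; move: dis; rewrite -fsetI_eq0 => /eqP->.
  rewrite cardfs0 subn0 cardfsD (fsetIidPr BA) PoszD cAt -subzn ?fsubset_leq_card //.
  have [-> _] := BP; rewrite cA.
  set ks := [seq tdeg p | p <- S1].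
  have ksE : ks = [seq k i | i <- enum 'I_n & i != t].
    by rewrite /ks /S1 -map_comp; apply: eq_map => i /=; rewrite /tdeg fk.
  have perm_ks : perm_eq (rcons ks (k t)) [seq k i | i <- enum 'I_n].
    rewrite ksE -map_rcons; apply: perm_map; apply: uniq_perm.
    + by rewrite rcons_uniq mem_filter eqxx filter_uniq ?enum_uniq.
    + exact: enum_uniq.
    + by move=> i; rewrite mem_rcons inE mem_filter mem_enum andbT orbN.
  have size_ks : size (rcons ks (k t)) = n.
    by rewrite (perm_size perm_ks) size_map size_enum_ord.
  have sum_ks : (\sum_(j <- rcons ks (k t)) j.-1 = \sum_i (k i).-1)%N.
    by rewrite (perm_big _ perm_ks) big_map big_enum.
  have prod_ks : (\prod_(j <- rcons ks (k t)) j = \prod_i k i)%N.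
    by rewrite (perm_big _ perm_ks) big_map big_enum.
  have := @space_dim_diff_symmetry (rcons ks (k t)) (M - m - 1).
  rewrite (perm_all _ perm_ks) sum_ks prod_ks -ME size_ks.
  rewrite (_ : M - 1 - (M - m - 1) = m); last by ring.
  rewrite [space_dim_diff n _ m]space_dim_diff_small; last first.
    rewrite (perm_all _ perm_ks); apply/allP => _ /mapP[i _ ->].
    have : (L <= k i)%N by apply: leq_bigmin_seq; rewrite mem_index_enum.
    by move: mL; rewrite -lez_nat; lia.
  rewrite space_dim_diff_rcons => sym.
  have {sym}<- := sym _; last by apply/allP => _ /mapP[i _ ->].
  rewrite (_ : M - m - 1 - (k t)%:Z = M - m - (k t)%:Z - 1); last by ring.
  by ring.
- by move=> Q; rewrite !inE => /orP[/AtS1 //|/andP[_ /S1A]].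
move=> q.
have [g [gd gq]] : exists g : {mpoly (complex R)[n]},
    polyspace (M - m - 1) g /\
    {in A `\` B, forall Q : {ffun 'I_n -> complex R}, g.@[Q] = q Q}.
  rewrite ME; exact: complement_interpolation (fun i => eq_leq (fk i)) zA cA BA BP q.
have [h [hd hq]] := Atint (fun Q => (q Q - g.@[Q]) / (f t).@[Q]).
exists (g + f t * h)%R; split=> [|Q].
  have fhd : polyspace (M - m - 1) (f t * h).
    move: hd; case E : (M - m - (k t)%:Z - 1) => [e|e] /=; last first.
      by move/eqP->; rewrite mulr0; case: (M - m - 1) => //= e'; rewrite msize0.
    move=> he; apply: (@polyspaceW _ _ (k t + e)%N); first by lia.
    by apply: msizeM_leq; rewrite ?fk.
  have := @polyspace_sum _ _ (M - m - 1) bool [:: true; false] predT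
    (fun b => if b then g else f t * h).
  by rewrite big_cons big_seq1; apply => -[].
rewrite inE mevalD mevalM; case: (boolP (Q \in A)) => QA.
  have QAt : Q \notin At.
    by apply/negP => QAt; have : Q \in At `&` A; [rewrite inE QAt | rewrite AtA].
  rewrite (negPf QAt) /= => QC; rewrite (zA Q).1 // mul0r addr0.
  exact: gq.
have -> : (Q \in A `\` B) = false by rewrite inE (negPf QA) andbF.
rewrite orbF => QAt.
have ftQ : (f t).@[Q] != 0.
  apply: contra QA => /eqP ft; apply/zA => i.
  have [->//|it] := eqVneq i t.
  by apply/eqP/(allP (AtS1 Q QAt)); rewrite map_f // mem_filter it mem_enum.
by rewrite hq // [_ * (_ / _)]mulrC divfK // addrC subrK.
Qed.
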